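(* Let $M_t$, $t\in[0,T)$, be a family of smooth closed strictly convex surfaces in $\mathbb{R}^3$ flowing according to $\frac{d}{dt}X=-|A|^2\nu$. Then $$\max_{M_t}\frac{(\lambda_1+\lambda_2)(\lambda_1-\lambda_2)^2}{2\lambda_1\lambda_2}=\max_{M_t}\frac{H\cdot(2|A|^2-H^2)}{H^2-|A|^2}$$ is non-increasing in time.
   Context: A closed surface is a compact connected embedded surface without boundary. $X=X(x,t)$ is the (smooth) embedding vector of $M_t$ into $\mathbb{R}^3$, $\frac{d}{dt}X$ its total time derivative, and $\nu$ the outer unit normal to $M_t$. The principal curvatures $\lambda_1,\lambda_2$ are the eigenvalues of the second fundamental form with respect to the induced metric, with sign such that round spheres have positive principal curvatures. A surface is strictly convex if all its principal curvatures are strictly positive. $H=\lambda_1+\lambda_2$ and $|A|^2=\lambda_1^2+\lambda_2^2$. *)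

(* Defs.v *)
From HB Require Import structures.
From mathcomp Require Import all_boot all_order all_algebra.
From mathcomp Require Import all_classical all_reals all_analysis.

Set Implicit Arguments.
Unset Strict Implicit.
Unset Printing Implicit Defensive.

Import Order.TTheory GRing.Theory Num.Theory.
Import numFieldNormedType.Exports.

Local Open Scope classical_set_scope.
Local Open Scope ring_scope.

Definition iter_derive (R : realType) (V W : normedModType R)
    (f : V -> W) (vs : seq V) : V -> W :=
  foldr (fun v g x => 'D_v g x) f vs.

(* For finite-dimensional V, this is C^infinity on the open set D. *)
Definition smooth_open (R : realType) (V W : normedModType R)
    (D : set V) (f : V -> W) : Prop :=
  forall (vs : seq V) (x : V), D x -> differentiable (iter_derive f vs) x.

(* Smoothness on an arbitrary set, by local smooth extension. It is used with
   D = U x [0, T), where it means smoothness up to the initial time; for open D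
   it agrees with smooth_open. *)
Definition smooth_on (R : realType) (V W : normedModType R)
    (D : set V) (f : V -> W) : Prop :=
  forall x, D x -> exists (O : set V) (F : V -> W),
    [/\ open O, O x, smooth_open O F & forall y, O y -> D y -> F y = f y].

(* A smooth structure on a surface without boundary, given by local
   parametrizations [par i] of open subsets of S by open subsets [dom i] of the
   plane; [coord i] is the chart inverse to [par i]. *)
Record smooth_atlas (R : realType) (S : topologicalType) := SmoothAtlas {
  idx : Type ;
  dom : idx -> set 'rV[R]_2 ;
  par : idx -> 'rV[R]_2 -> S ;
  coord : idx -> S -> 'rV[R]_2 ;
  dom_open : forall i, open (dom i) ;
  par_cover : forall p, exists i, (par i @` dom i) p ;
  parK : forall i u, dom i u -> coord i (par i u) = u ;
  par_continuous : forall i u, dom i u -> {for u, continuous (par i)} ;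
  par_open : forall i (V : set 'rV[R]_2),
    open V -> V `<=` dom i -> open (par i @` V) ;
  transition_smooth : forall i j,
    smooth_on (dom i `&` par i @^-1` (par j @` dom j)) (coord j \o par i) }.

Arguments idx {R S} A : rename.
Arguments dom {R S} A i _ : rename.
Arguments par {R S} A i _ : rename.
Arguments coord {R S} A i _ : rename.

Definition closed_surface (S : topologicalType) : Prop :=
  [/\ [set: S] !=set0, hausdorff_space S, compact [set: S]
    & connected [set: S]].

Section Geometry.
Context {R : realType}.

Definition dot (n : nat) (v w : 'rV[R]_n) : R := \sum_(i < n) v 0 i * w 0 i.

Definition partial (F : 'rV[R]_2 -> 'rV[R]_3) (i : 'I_2) :
  'rV[R]_2 -> 'rV[R]_3 := fun u => 'D_(delta_mx 0 i) F u.

Definition first_form (F : 'rV[R]_2 -> 'rV[R]_3) (u : 'rV[R]_2) : 'M[R]_2 :=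
  \matrix_(i, j) dot (partial F i u) (partial F j u).

(* The sign makes the form positive on round spheres when n is the outer
   normal. *)
Definition second_form (F : 'rV[R]_2 -> 'rV[R]_3) (n : 'rV[R]_3)
    (u : 'rV[R]_2) : 'M[R]_2 :=
  \matrix_(i, j) - dot (partial (partial F j) i u) n.

Variables (S : topologicalType) (A : smooth_atlas R S).

(* Since S is compact, an injective immersion is a homeomorphism onto its
   image. *)
Definition embedding (Y : S -> 'rV[R]_3) : Prop :=
  injective Y /\
  forall i u, dom A i u ->
    row_free (\matrix_(k < 2) partial (Y \o par A i) k u).

Definition exterior_region (M : set 'rV[R]_3) : set 'rV[R]_3 :=
  [set q | ~ M q /\ ~ bounded_set (connected_component (~` M) q)].

Definition outer_unit_normal (Y : S -> 'rV[R]_3) (p : S) (n : 'rV[R]_3) :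
    Prop :=
  [/\ dot n n = 1,
      forall i u k, dom A i u -> par A i u = p ->
        dot (partial (Y \o par A i) k u) n = 0
    & \forall s \near 0^'+, exterior_region (range Y) (Y p + s *: n)].

(* l1 and l2 are the eigenvalues, with multiplicity, of the second fundamental
   form with respect to the metric: v *m II = l *: (v *m I). *)
Definition principal_curvatures (Y : S -> 'rV[R]_3) (p : S) (n : 'rV[R]_3)
    (l1 l2 : R) : Prop :=
  forall i u, dom A i u -> par A i u = p ->
    char_poly (second_form (Y \o par A i) n u
                 *m invmx (first_form (Y \o par A i) u))
    = ('X - l1%:P) * ('X - l2%:P).

Definition time_interval (T : \bar R) : set R :=
  [set t | 0 <= t /\ (t%:E < T)%E].

Definition smooth_family (T : \bar R) (X : S -> R -> 'rV[R]_3) : Prop :=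
  forall i, smooth_on (dom A i `*` time_interval T)
    (fun ut : 'rV[R]_2 * R => X (par A i ut.1) ut.2).

(* Derivative relative to I: two-sided inside, one-sided at an endpoint. *)
Definition derivative_within (I : set R) (c : R -> 'rV[R]_3) (t : R)
    (v : 'rV[R]_3) : Prop :=
  (s - t)^-1 *: (c s - c t) @[s --> within I t^'] --> v.

End Geometry.

Definition mean_curvature (R : realType) (l1 l2 : R) : R := l1 + l2.

Definition normA2 (R : realType) (l1 l2 : R) : R := l1 ^+ 2 + l2 ^+ 2.

Definition is_max (R : realType) (E : set R) (m : R) : Prop :=
  E m /\ ubound E m.

(* Main.v *)
Require Import Defs.
From HB Require Import structures.
From mathcomp Require Import all_boot all_order all_algebra.
From mathcomp Require Import all_classical all_reals all_analysis.
From mathcomp Require Import ring lra.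

(** With [H = l1 + l2] and [K = l1 * l2], the quantity of the theorem is
    [w = H * (H ^+ 2 - 4 * K) / (2 * K)]: it is smooth along the flow even
    where the principal curvatures are not. Let [m t] be its maximum over the
    surface at time [t]. By compactness, [m] is upper semicontinuous. At a
    time [t > 0], let the maximum be attained at [p]. If it is zero, then
    [m s >= 0 = m t] for every [s], since [w >= 0]. Otherwise [p] is not an
    umbilic, and [d w / d t <= 0] at [p], so that
    [m s >= w p s >= m t - e * (t - s)] for [s < t] close to [t], whatever
    [e > 0]. These left estimates and the semicontinuity imply the
    monotonicity ([nonincreasing_of_left_estimate]).

    The heart of the matter is the sign of the time derivative at a non-umbilic
    spatial maximum ([pinching_derivative_le0]). Suppose first that the surface
    is the graph of a function [f] over its tangent plane at the point, with
    axes in principal directions. The flow becomes [f_t = v * (H ^+ 2 - 2 * K)],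
    where [v ^+ 2 = 1 + f_1 ^+ 2 + f_2 ^+ 2], and everything at the point is a
    polynomial in the derivatives of [f] up to order four. With [x = f_11] and
    [y = f_22], the conditions [w_1 = w_2 = 0] eliminate [f_111] and [f_222],
    and what remains is ([evolution_identity])

      [w_t = 2 x w_11 + 2 y w_22 - 2 x y (x - y)^2
             - C(x, y) f_112^2 - C(y, x) f_122^2]

    with [C >= 0]. The second derivatives [w_11] and [w_22] are nonpositive at
    a maximum.

    A local parametrization [F] is brought to this form without solving for a
    graph. Let [y1], [y2], [f] be the coordinates of [F] in an orthonormal
    frame adapted to the point. Near the point there are vector fields [E1],
    [E2] on the parameter domain with [E_i y_k = 1] if [i = k] and [0]
    otherwise, and a field [Et], with time component one, which kills [y1] and
    [y2]. Their brackets are tangent to the time slices and kill [y1] and [y2],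
    so they vanish ([vfield_comm]). The fields thus act on smooth functions as
    the partial derivatives of the graph picture, and the whole computation
    takes place in a commutative ring with commuting derivations
    ([graph_max_principle], [param_max_principle], [frame_max_principle]). That
    ring is the ring [cinf] of smooth functions on a neighbourhood of the
    point; its derivations commute by Schwarz's theorem ([derive_comm]).

    The normal is smooth for the following reason. Products of two entries of
    the second fundamental form do not depend on the sign of the normal, so
    [|A| ^+ 2] and [K] are rational in the derivatives of [F]
    ([curvature_funs]); then the flow equation gives the normal itself as
    [- F_t / |A| ^+ 2] ([exists_flow_funs]). *)

Set Implicit Arguments.
Unset Strict Implicit.
Unset Printing Implicit Defensive.

Import Order.TTheory GRing.Theory Num.Theory.
Import numFieldNormedType.Exports.

Local Open Scope classical_set_scope.
Local Open Scope ring_scope.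

(** * The evolution identity at a non-umbilic maximum *)

(** The coefficients of the squares of [f_112] and [f_122] in
    [evolution_identity], up to sign. *)
Definition gradient_coef (R : realFieldType) (x y : R) : R :=
  (5 * y ^+ 8 - 4 * x * y ^+ 7 + 46 * x ^+ 2 * y ^+ 6 + 48 * x ^+ 3 * y ^+ 5
   + 72 * x ^+ 4 * y ^+ 4 + 44 * x ^+ 5 * y ^+ 3 + 34 * x ^+ 6 * y ^+ 2
   + 8 * x ^+ 7 * y + 3 * x ^+ 8)
  / ((2 * y ^+ 2 + x * y + x ^+ 2) ^+ 2 * x ^+ 2 * y ^+ 2).

Lemma gradient_coef_ge0 (R : realFieldType) (x y : R) :
  0 < x -> 0 < y -> 0 <= gradient_coef x y.
Proof.
move=> x0 y0; apply: divr_ge0; last first.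
  move/ltW: x0 => x0; move/ltW: y0 => y0.
  by rewrite !(sqr_ge0, addr_ge0, mulr_ge0, exprn_ge0).
(* the square absorbs the only monomial with a negative coefficient *)
have -> : 5 * y ^+ 8 - 4 * x * y ^+ 7 + 46 * x ^+ 2 * y ^+ 6
   + 48 * x ^+ 3 * y ^+ 5
   + 72 * x ^+ 4 * y ^+ 4 + 44 * x ^+ 5 * y ^+ 3 + 34 * x ^+ 6 * y ^+ 2
   + 8 * x ^+ 7 * y + 3 * x ^+ 8
  = y ^+ 6 * (y ^+ 2 + (2 * y - x) ^+ 2 + 45 * x ^+ 2) + 48 * x ^+ 3 * y ^+ 5
   + 72 * x ^+ 4 * y ^+ 4 + 44 * x ^+ 5 * y ^+ 3 + 34 * x ^+ 6 * y ^+ 2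
   + 8 * x ^+ 7 * y + 3 * x ^+ 8 by ring.
move/ltW: x0 => x0; move/ltW: y0 => y0.
by rewrite !(sqr_ge0, addr_ge0, mulr_ge0, exprn_ge0).
Qed.

(** The letters [a], [b], [c], [d] stand for the third derivatives [f_111],
    [f_112], [f_122], [f_222] of a graph function at a point where [f_11 = x],
    [f_12 = 0], [f_22 = y], and [P], [Q], [Z] for the fourth derivatives
    [f_1111], [f_1122], [f_2222]; indices on [H], [K], [w] and
    [q = H ^+ 2 - 2 * K] denote derivatives. The fourth derivatives cancel
    because [2 * x] and [2 * y] are the coefficients of the linearized flow.
    The equations [w_1 = w_2 = 0] then express [a] through [c] and [d] through
    [b], and this leaves a definite quadratic form in [b] and [c]. *)
Lemma evolution_identity (R : realFieldType) (x y a b c d P Q Z : R)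
    (H K w H1 H2 K1 K2 H11 H22 K11 K22 q11 q22 Ht Kt w11 w22 wt : R) :
  0 < x -> 0 < y -> x != y ->
  H = x + y -> K = x * y ->
  H1 = a + c -> H2 = b + d -> K1 = y * a + x * c -> K2 = y * b + x * d ->
  H11 + 3 * H * x ^+ 2 = P + Q + 2 * x ^+ 2 * y ->
  H22 + 3 * H * y ^+ 2 = Q + Z + 2 * x * y ^+ 2 ->
  K11 + 4 * K * x ^+ 2 = y * P + x * Q + 2 * a * c - 2 * b ^+ 2 ->
  K22 + 4 * K * y ^+ 2 = y * Q + x * Z + 2 * b * d - 2 * c ^+ 2 ->
  q11 = 2 * H * H11 + 2 * H1 ^+ 2 - 2 * K11 ->
  q22 = 2 * H * H22 + 2 * H2 ^+ 2 - 2 * K22 ->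
  Ht = q11 + q22 + (H ^+ 2 - 2 * K) * (x ^+ 2 + y ^+ 2) ->
  Kt = y * (q11 + (H ^+ 2 - 2 * K) * x ^+ 2)
       + x * (q22 + (H ^+ 2 - 2 * K) * y ^+ 2) ->
  2 * K * w = H * (H ^+ 2 - 4 * K) ->
  2 * K1 * w = (3 * H ^+ 2 - 4 * K) * H1 - 4 * H * K1 ->
  2 * K2 * w = (3 * H ^+ 2 - 4 * K) * H2 - 4 * H * K2 ->
  2 * (K11 * w + K * w11)
    = (3 * H ^+ 2 - 4 * K) * H11 + 6 * H * H1 ^+ 2 - 8 * H1 * K1
      - 4 * H * K11 ->
  2 * (K22 * w + K * w22)
    = (3 * H ^+ 2 - 4 * K) * H22 + 6 * H * H2 ^+ 2 - 8 * H2 * K2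
      - 4 * H * K22 ->
  2 * (Kt * w + K * wt) = (3 * H ^+ 2 - 4 * K) * Ht - 4 * H * Kt ->
  wt = 2 * x * w11 + 2 * y * w22 - 2 * x * y * (x - y) ^+ 2
       - gradient_coef x y * b ^+ 2 - gradient_coef y x * c ^+ 2.
Proof.
move=> x0 y0 xy eH eK eH1 eH2 eK1 eK2 eH11 eH22 eK11 eK22 eq11 eq22 eHt eKt.
move=> ew ew1 ew2 ew11 ew22 ewt.
have xn0 : x != 0 by rewrite gt_eqF.
have yn0 : y != 0 by rewrite gt_eqF.
have xyn0 : x - y != 0 by rewrite subr_eq0.
have Kn0 : 2 * K != 0 by rewrite eK !mulf_neq0// pnatr_eq0.
have A0 : 2 * x ^+ 2 + x * y + y ^+ 2 != 0.
  by rewrite gt_eqF// !addr_gt0// ?mulr_gt0// ?exprn_gt0.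
have B0 : 2 * y ^+ 2 + x * y + x ^+ 2 != 0.
  by rewrite gt_eqF// !addr_gt0// ?mulr_gt0// ?exprn_gt0.
have {}ew : w = (x + y) * (x - y) ^+ 2 / (2 * x * y).
  apply: (mulfI Kn0); rewrite ew eH eK; field.
  by rewrite xn0 yn0.
(* the equation [w_1 = 0] has the factor [x - y] *)
have ea : a = c * (x * (2 * y ^+ 2 + x * y + x ^+ 2))
              / (y * (2 * x ^+ 2 + x * y + y ^+ 2)).
  have E : (x - y) * (a * (y * (2 * x ^+ 2 + x * y + y ^+ 2))
                     - c * (x * (2 * y ^+ 2 + x * y + x ^+ 2))) = 0.
    move: ew1; rewrite ew eH eK eH1 eK1 => /eqP.
    rewrite -subr_eq0 => /eqP/(congr1 (fun z => - (z * (x * y)))).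
    rewrite mul0r oppr0 => <-; field.
    by rewrite xn0 yn0.
  move/eqP: E; rewrite mulf_eq0 (negPf xyn0)/= subr_eq0 => /eqP <-.
  by field; rewrite yn0 A0.
have ed : d = b * (y * (2 * x ^+ 2 + x * y + y ^+ 2))
              / (x * (2 * y ^+ 2 + x * y + x ^+ 2)).
  have E : (x - y) * (d * (x * (2 * y ^+ 2 + x * y + x ^+ 2))
                     - b * (y * (2 * x ^+ 2 + x * y + y ^+ 2))) = 0.
    move: ew2; rewrite ew eH eK eH2 eK2 => /eqP.
    rewrite -subr_eq0 => /eqP/(congr1 (fun z => (z * (x * y)))).
    rewrite mul0r => <-; field.
    by rewrite xn0 yn0.
  move/eqP: E; rewrite mulf_eq0 (negPf xyn0)/= subr_eq0 => /eqP <-.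
  by field; rewrite xn0 B0.
have {}eH11 : H11 = P + Q + 2 * x ^+ 2 * y - 3 * H * x ^+ 2
  by rewrite -eH11; ring.
have {}eH22 : H22 = Q + Z + 2 * x * y ^+ 2 - 3 * H * y ^+ 2
  by rewrite -eH22; ring.
have {}eK11 : K11 = y * P + x * Q + 2 * a * c - 2 * b ^+ 2 - 4 * K * x ^+ 2
  by rewrite -eK11; ring.
have {}eK22 : K22 = y * Q + x * Z + 2 * b * d - 2 * c ^+ 2 - 4 * K * y ^+ 2
  by rewrite -eK22; ring.
have {}ew11 : w11 = ((3 * H ^+ 2 - 4 * K) * H11 + 6 * H * H1 ^+ 2 - 8 * H1 * K1
      - 4 * H * K11 - 2 * K11 * w) / (2 * K).
  apply: (mulIf Kn0); rewrite mulfVK//.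
  by rewrite -ew11; ring.
have {}ew22 : w22 = ((3 * H ^+ 2 - 4 * K) * H22 + 6 * H * H2 ^+ 2 - 8 * H2 * K2
      - 4 * H * K22 - 2 * K22 * w) / (2 * K).
  apply: (mulIf Kn0); rewrite mulfVK//.
  by rewrite -ew22; ring.
have {}ewt : wt
    = ((3 * H ^+ 2 - 4 * K) * Ht - 4 * H * Kt - 2 * Kt * w) / (2 * K).
  apply: (mulIf Kn0); rewrite mulfVK//.
  by rewrite -ewt; ring.
rewrite /gradient_coef ew11 ew22 ewt eHt eKt eq11 eq22 eH11 eH22 eK11 eK22.
rewrite eH1 eK1 eH2 eK2 ew ea ed eH eK.
field.
by rewrite xn0 yn0 B0 (mulrC y) A0.
Qed.

(** * Graphs over their tangent plane *)

(** For goals which are a known equation up to a ring identity. *)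
Lemma eq_of_sub_eq (V : zmodType) (a b c d : V) :
  a = b -> c - d = a - b -> c = d.
Proof. by move=> -> /eqP; rewrite subrr subr_eq0 => /eqP. Qed.

Section Derivations.
Variable A : comNzRingType.
Implicit Types (a b c : A) (d : A -> A).

Record derivation d : Prop := Derivation {
  derD : forall a b, d (a + b) = d a + d b;
  derM : forall a b, d (a * b) = d a * b + a * d b }.

Lemma der0 d : derivation d -> d 0 = 0.
Proof. by move=> D; apply: (addrI (d 0)); rewrite -(derD D) !addr0. Qed.

Lemma der1 d : derivation d -> d 1 = 0.
Proof.
move=> D; apply: (addrI (d 1)).
by rewrite addr0 -[RHS](congr1 d (mulr1 1)) (derM D) mulr1 mul1r.
Qed.

Lemma derN d (D : derivation d) a : d (- a) = - d a.
Proof. by apply: (addrI (d a)); rewrite -(derD D) !subrr (der0 D). Qed.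

Lemma der_nat d (D : derivation d) n : d n%:R = 0.
Proof.
elim: n => [|n IH]; first exact: der0.
by rewrite -natr1 (derD D) IH der1// addr0.
Qed.

Lemma derX2 d (D : derivation d) a : d (a ^+ 2) = 2 * a * d a.
Proof. by rewrite expr2 (derM D); ring. Qed.

Lemma derX3 d (D : derivation d) a : d (a ^+ 3) = 3 * a ^+ 2 * d a.
Proof. by rewrite exprS (derM D) (derX2 D); ring. Qed.

Lemma derX4 d (D : derivation d) a : d (a ^+ 4) = 4 * a ^+ 3 * d a.
Proof. by rewrite exprS (derM D) (derX3 D); ring. Qed.

Definition derE d (D : derivation d) :=
  (derD D, derM D, derN D, derX2 D, derX3 D, derX4 D, der_nat D, der1 D, der0 D).

End Derivations.

(** In this section [E1], [E2], [Et] are the partial derivatives for a graph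
    function [f], and [ev] is the evaluation at a point where the tangent plane
    is horizontal. The element [v] is the area density, and the hypotheses [eH],
    [eK], [ef] are the classical formulas for the mean curvature, the Gauss
    curvature and the flow of a graph. *)
Section Graph.
Variables (R : realFieldType) (A : comNzRingType) (ev : {rmorphism A -> R}).
Variables (E1 E2 Et : A -> A).
Hypotheses (D1 : derivation E1) (D2 : derivation E2) (Dt : derivation Et).
Hypothesis E21 : forall a, E2 (E1 a) = E1 (E2 a).
Hypothesis Et1 : forall a, Et (E1 a) = E1 (Et a).
Hypothesis Et2 : forall a, Et (E2 a) = E2 (Et a).
Variables (f v H K w : A).
Hypothesis ev2 : v ^+ 2 = 1 + E1 f ^+ 2 + E2 f ^+ 2.
Hypothesis eH : H * v ^+ 3
  = (1 + E2 f ^+ 2) * E1 (E1 f) - 2 * E1 f * E2 f * E1 (E2 f)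
    + (1 + E1 f ^+ 2) * E2 (E2 f).
Hypothesis eK : K * v ^+ 4 = E1 (E1 f) * E2 (E2 f) - E1 (E2 f) ^+ 2.
Hypothesis ew : 2 * K * w = H * (H ^+ 2 - 4 * K).
Hypothesis ef : Et f = (H ^+ 2 - 2 * K) * v.
Hypotheses (f1 : ev (E1 f) = 0) (f2 : ev (E2 f) = 0) (v0 : ev v = 1).
Hypotheses (f12 : ev (E1 (E2 f)) = 0).
Hypotheses (f11 : 0 < ev (E1 (E1 f))) (f22 : 0 < ev (E2 (E2 f))).
Hypothesis fxy : ev (E1 (E1 f)) != ev (E2 (E2 f)).
Hypotheses (w1 : ev (E1 w) = 0) (w2 : ev (E2 w) = 0).
Hypotheses (w11 : ev (E1 (E1 w)) <= 0) (w22 : ev (E2 (E2 w)) <= 0).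

Definition evE := (rmorphD ev, rmorphM ev, rmorphN ev, rmorph1 ev, rmorph0 ev,
  rmorphXn ev, rmorph_nat ev).

Let two_inj (a b : R) : 2 * a = 2 * b -> a = b.
Proof. by apply: mulfI; rewrite pnatr_eq0. Qed.

(** Differentiating the equation for [v ^+ 2]: the terms of first order
    vanish with the gradient of [f]. *)
Lemma graph_normal_jet : [/\ ev (E1 v) = 0, ev (E2 v) = 0,
   ev (E1 (E1 v)) = ev (E1 (E1 f)) ^+ 2,
   ev (E2 (E2 v)) = ev (E2 (E2 f)) ^+ 2 & ev (Et v) = 0].
Proof.
have v1 : ev (E1 v) = 0.
  apply: two_inj; have := congr1 (ev \o E1) ev2.
  by rewrite /= !(derE D1) !evE f1 f2 v0 => e; apply: (eq_of_sub_eq e); ring.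
have v2 : ev (E2 v) = 0.
  apply: two_inj; have := congr1 (ev \o E2) ev2.
  by rewrite /= !(derE D2) !evE f1 f2 v0 => e; apply: (eq_of_sub_eq e); ring.
split=> //.
- apply: two_inj; have := congr1 (ev \o E1 \o E1) ev2.
  rewrite /= !(derE D1) !evE f1 f2 v0 v1 f12 => e.
  by apply: (eq_of_sub_eq e); ring.
- apply: two_inj; have := congr1 (ev \o E2 \o E2) ev2.
  rewrite /= !(derE D2) !evE f1 f2 v0 v2 E21 f12 => e.
  by apply: (eq_of_sub_eq e); ring.
- apply: two_inj; have := congr1 (ev \o Et) ev2.
  by rewrite /= !(derE Dt) !evE f1 f2 v0 => e; apply: (eq_of_sub_eq e); ring.
Qed.

(** The derivatives of [H], [K] and [w] at the point come from differentiating
    their polynomial equations, in which [f_1 = f_2 = f_12 = 0] kills most of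
    the terms. Time derivatives of [f_ij] become space derivatives of the speed
    because the derivations commute. *)
Lemma graph_max_principle : ev (Et w) <= 0.
Proof.
have [v1 v2 v11 v22 vt] := graph_normal_jet.
move: f11 f22 fxy => x0 y0 xy.
set x := ev (E1 (E1 f)) in v11 x0 xy *.
set y := ev (E2 (E2 f)) in v22 y0 xy *.
have f112 : ev (E1 (E1 (E2 f))) = ev (E2 (E1 (E1 f))) by rewrite E21 E21.
have q11 : ev (E1 (E1 (Et f))) = ev (E1 (E1 (H ^+ 2 - 2 * K)))
    + ev (H ^+ 2 - 2 * K) * x ^+ 2.
  by rewrite ef !(derM D1, derD D1) !evE v0 v1 v11; ring.
have q22 : ev (E2 (E2 (Et f))) = ev (E2 (E2 (H ^+ 2 - 2 * K)))
    + ev (H ^+ 2 - 2 * K) * y ^+ 2.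
  by rewrite ef !(derM D2, derD D2) !evE v0 v2 v22; ring.
have ft11 : ev (Et (E1 (E1 f))) = ev (E1 (E1 (Et f))) by rewrite Et1 Et1.
have ft22 : ev (Et (E2 (E2 f))) = ev (E2 (E2 (Et f))) by rewrite Et2 Et2.
have H0 : ev H = x + y.
  have := congr1 ev eH; rewrite !evE f1 f2 v0 f12 -/x -/y => e.
  by apply: (eq_of_sub_eq e); ring.
have K0 : ev K = x * y.
  have := congr1 ev eK; rewrite !evE v0 f12 -/x -/y => e.
  by apply: (eq_of_sub_eq e); ring.
have H1 : ev (E1 H) = ev (E1 (E1 (E1 f))) + ev (E1 (E2 (E2 f))).
  have := congr1 (ev \o E1) eH; rewrite /= !(derE D1) !evE f1 f2 v0 v1 f12.
  by move=> e; apply: (eq_of_sub_eq e); ring.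
have H2 : ev (E2 H) = ev (E2 (E1 (E1 f))) + ev (E2 (E2 (E2 f))).
  have := congr1 (ev \o E2) eH; rewrite /= !(derE D2) !evE f1 f2 v0 v2 f12.
  by move=> e; apply: (eq_of_sub_eq e); ring.
have K1 : ev (E1 K) = y * ev (E1 (E1 (E1 f))) + x * ev (E1 (E2 (E2 f))).
  have := congr1 (ev \o E1) eK; rewrite /= !(derE D1) !evE v0 v1 f12 -/x -/y.
  by move=> e; apply: (eq_of_sub_eq e); ring.
have K2 : ev (E2 K) = y * ev (E2 (E1 (E1 f))) + x * ev (E2 (E2 (E2 f))).
  have := congr1 (ev \o E2) eK; rewrite /= !(derE D2) !evE v0 v2 f12 -/x -/y.
  by move=> e; apply: (eq_of_sub_eq e); ring.
have H11 : ev (E1 (E1 H)) + 3 * ev H * x ^+ 2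
    = ev (E1 (E1 (E1 (E1 f)))) + ev (E1 (E1 (E2 (E2 f)))) + 2 * x ^+ 2 * y.
  have := congr1 (ev \o E1 \o E1) eH; rewrite /= !(derE D1) !evE.
  rewrite f1 f2 v0 v1 v11 f12 -/x -/y.
by move=> e; apply: (eq_of_sub_eq e); ring.
have H22 : ev (E2 (E2 H)) + 3 * ev H * y ^+ 2
    = ev (E1 (E1 (E2 (E2 f)))) + ev (E2 (E2 (E2 (E2 f)))) + 2 * x * y ^+ 2.
  have := congr1 (ev \o E2 \o E2) eH; rewrite /= !(derE D2) !E21 !evE.
  rewrite f1 f2 v0 v2 v22 f12 -/x -/y.
  by move=> e; apply: (eq_of_sub_eq e); ring.
have K11 : ev (E1 (E1 K)) + 4 * ev K * x ^+ 2
    = y * ev (E1 (E1 (E1 (E1 f)))) + x * ev (E1 (E1 (E2 (E2 f))))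
      + 2 * ev (E1 (E1 (E1 f))) * ev (E1 (E2 (E2 f)))
      - 2 * ev (E1 (E1 (E2 f))) ^+ 2.
  have := congr1 (ev \o E1 \o E1) eK; rewrite /= !(derE D1) !evE.
  rewrite v0 v1 v11 f12 -/x -/y.
  by move=> e; apply: (eq_of_sub_eq e); ring.
have K22 : ev (E2 (E2 K)) + 4 * ev K * y ^+ 2
    = y * ev (E1 (E1 (E2 (E2 f)))) + x * ev (E2 (E2 (E2 (E2 f))))
      + 2 * ev (E2 (E1 (E1 f))) * ev (E2 (E2 (E2 f)))
      - 2 * ev (E1 (E2 (E2 f))) ^+ 2.
  have := congr1 (ev \o E2 \o E2) eK; rewrite /= !(derE D2) !E21 !evE.
  rewrite v0 v2 v22 f12 -/x -/y.
  by move=> e; apply: (eq_of_sub_eq e); ring.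
have Ht : ev (Et H) = ev (E1 (E1 (Et f))) + ev (E2 (E2 (Et f))).
  have := congr1 (ev \o Et) eH; rewrite /= !(derE Dt) !evE f1 f2 v0 vt f12.
  by rewrite ft11 ft22 => e; apply: (eq_of_sub_eq e); ring.
have Kt : ev (Et K) = y * ev (E1 (E1 (Et f))) + x * ev (E2 (E2 (Et f))).
  have := congr1 (ev \o Et) eK; rewrite /= !(derE Dt) !evE v0 vt f12 -/x -/y.
  by rewrite ft11 ft22 => e; apply: (eq_of_sub_eq e); ring.
have q11' : ev (E1 (E1 (H ^+ 2 - 2 * K)))
    = 2 * ev H * ev (E1 (E1 H)) + 2 * ev (E1 H) ^+ 2 - 2 * ev (E1 (E1 K)).
  by rewrite !(derE D1) !evE; ring.
have q22' : ev (E2 (E2 (H ^+ 2 - 2 * K)))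
    = 2 * ev H * ev (E2 (E2 H)) + 2 * ev (E2 H) ^+ 2 - 2 * ev (E2 (E2 K)).
  by rewrite !(derE D2) !evE; ring.
have w0 := congr1 ev ew; rewrite !evE in w0.
have W1 := congr1 (ev \o E1) ew; rewrite /= !(derE D1) !evE w1 in W1.
have W2 := congr1 (ev \o E2) ew; rewrite /= !(derE D2) !evE w2 in W2.
have Wt := congr1 (ev \o Et) ew; rewrite /= !(derE Dt) !evE in Wt.
have W11 := congr1 (ev \o E1 \o E1) ew; rewrite /= !(derE D1) !evE w1 in W11.
have W22 := congr1 (ev \o E2 \o E2) ew; rewrite /= !(derE D2) !evE w2 in W22.
rewrite q11 in Ht Kt; rewrite q22 in Ht Kt.
have q0 : ev (H ^+ 2 - 2 * K) = ev H ^+ 2 - 2 * ev K by rewrite !evE.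
rewrite q0 in Ht Kt.
have Ht' : ev (Et H) = ev (E1 (E1 (H ^+ 2 - 2 * K)))
    + ev (E2 (E2 (H ^+ 2 - 2 * K)))
    + (ev H ^+ 2 - 2 * ev K) * (x ^+ 2 + y ^+ 2) by rewrite Ht; ring.
rewrite f112 in K11.
have -> : ev (Et w)
    = 2 * x * ev (E1 (E1 w)) + 2 * y * ev (E2 (E2 w))
      - 2 * x * y * (x - y) ^+ 2
      - gradient_coef x y * ev (E2 (E1 (E1 f))) ^+ 2
      - gradient_coef y x * ev (E1 (E2 (E2 f))) ^+ 2.
  apply: (evolution_identity x0 y0 xy H0 K0 H1 H2 K1 K2 H11 H22 K11 K22
    q11' q22' Ht' Kt w0).
  - by apply: (eq_of_sub_eq W1); ring.
  - by apply: (eq_of_sub_eq W2); ring.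
  - by apply: (eq_of_sub_eq W11); ring.
  - by apply: (eq_of_sub_eq W22); ring.
  - by apply: (eq_of_sub_eq Wt); ring.
have P0 : 0 <= 2 * x * y * (x - y) ^+ 2.
  by rewrite !(sqr_ge0, mulr_ge0)// ltW.
have P1 : 0 <= gradient_coef x y * ev (E2 (E1 (E1 f))) ^+ 2.
  by rewrite mulr_ge0// ?sqr_ge0// gradient_coef_ge0.
have P2 : 0 <= gradient_coef y x * ev (E1 (E2 (E2 f))) ^+ 2.
  by rewrite mulr_ge0// ?sqr_ge0// gradient_coef_ge0.
have P3 : 2 * x * ev (E1 (E1 w)) <= 0.
  by rewrite mulr_ge0_le0// mulr_ge0// ltW.
have P4 : 2 * y * ev (E2 (E2 w)) <= 0.
  by rewrite mulr_ge0_le0// mulr_ge0// ltW.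
lra.
Qed.

End Graph.

(** * From a parametrization to a graph *)

Section VectorFields.
Variables (A : comNzRingType) (dt d1 d2 : A -> A).
Hypotheses (Dt : derivation dt) (D1 : derivation d1) (D2 : derivation d2).
Hypothesis d21 : forall a, d2 (d1 a) = d1 (d2 a).
Hypothesis dt1 : forall a, dt (d1 a) = d1 (dt a).
Hypothesis dt2 : forall a, dt (d2 a) = d2 (dt a).

Definition vfield (e p r a : A) : A := e * dt a + p * d1 a + r * d2 a.

Lemma vfield_derivation e p r : derivation (vfield e p r).
Proof.
split=> a b; rewrite /vfield.
  by rewrite !(derD Dt, derD D1, derD D2); ring.
by rewrite !(derM Dt, derM D1, derM D2); ring.
Qed.

(** The terms of second order cancel because [dt], [d1], [d2] commute. The
    conditions on [e] and [e'] are those of fields whose time components are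
    constant along each other, so that the bracket is tangent to the slices. *)
Lemma vfield_bracket e p r e' p' r' a :
  vfield e p r e' = 0 -> vfield e' p' r' e = 0 ->
  vfield e p r (vfield e' p' r' a) - vfield e' p' r' (vfield e p r a)
  = (vfield e p r p' - vfield e' p' r' p) * d1 a
    + (vfield e p r r' - vfield e' p' r' r) * d2 a.
Proof.
move=> c c'.
have -> : vfield e p r (vfield e' p' r' a) - vfield e' p' r' (vfield e p r a)
  = (vfield e p r p' - vfield e' p' r' p) * d1 a
    + (vfield e p r r' - vfield e' p' r' r) * d2 a
    + vfield e p r e' * dt a - vfield e' p' r' e * dt a.
  rewrite /vfield !(derD Dt, derD D1, derD D2, derM Dt, derM D1, derM D2).
  rewrite !d21 !dt1 !dt2; ring.
by rewrite c c' !mul0r addr0 subr0.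
Qed.

Variables (y1 y2 j : A).
Hypothesis jJ : j * (d1 y1 * d2 y2 - d1 y2 * d2 y1) = 1.

(** Cramer's rule, [j] being the inverse of the Jacobian determinant. *)
Lemma tangent_field_eq0 p r :
  p * d1 y1 + r * d2 y1 = 0 -> p * d1 y2 + r * d2 y2 = 0 -> p = 0 /\ r = 0.
Proof.
move=> k1 k2; split.
  have -> : p = j * (d1 y1 * d2 y2 - d1 y2 * d2 y1) * p by rewrite jJ mul1r.
  transitivity (j * (d2 y2 * (p * d1 y1 + r * d2 y1)
                     - d2 y1 * (p * d1 y2 + r * d2 y2))); first by ring.
  by rewrite k1 k2; ring.
have -> : r = j * (d1 y1 * d2 y2 - d1 y2 * d2 y1) * r by rewrite jJ mul1r.
transitivity (j * (d1 y1 * (p * d1 y2 + r * d2 y2)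
                   - d1 y2 * (p * d1 y1 + r * d2 y1))); first by ring.
by rewrite k1 k2; ring.
Qed.

(** The bracket is a tangent field which kills [y1] and [y2], hence zero. *)
Lemma vfield_comm e p r e' p' r' :
  vfield e p r e' = 0 -> vfield e' p' r' e = 0 ->
  vfield e p r (vfield e' p' r' y1) = vfield e' p' r' (vfield e p r y1) ->
  vfield e p r (vfield e' p' r' y2) = vfield e' p' r' (vfield e p r y2) ->
  forall a, vfield e p r (vfield e' p' r' a) = vfield e' p' r' (vfield e p r a).
Proof.
move=> c c' b1 b2 a; apply/eqP; rewrite -subr_eq0 vfield_bracket//.
have [|| -> ->] := @tangent_field_eq0 (vfield e p r p' - vfield e' p' r' p)
  (vfield e p r r' - vfield e' p' r' r).
- by rewrite -vfield_bracket// b1 subrr.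
- by rewrite -vfield_bracket// b2 subrr.
by rewrite !mul0r addr0.
Qed.

End VectorFields.

Definition metric (A : comNzRingType) (y1 y2 y3 : A) (d d' : A -> A) : A :=
  d y1 * d' y1 + d y2 * d' y2 + d y3 * d' y3.

(** The second fundamental form for the normal [(n1, n2, n3)], with the sign
    which makes it positive on round spheres for the outer normal. *)
Definition sff (A : comNzRingType) (n1 n2 n3 y1 y2 y3 : A) (d d' : A -> A) : A :=
  - (n1 * d (d' y1) + n2 * d (d' y2) + n3 * d (d' y3)).

(** The surface has coordinates [(y1, y2, f)] and normal [(n1, n2, n3)], in
    axes such that at the point the tangent plane is horizontal, the normal
    points down, [d1] and [d2] are orthonormal, and the second fundamental form
    is diagonal. *)
Section GraphGauge.
Variables (R : realFieldType) (A : comNzRingType) (ev : {rmorphism A -> R}).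
Variables (d1 d2 dt : A -> A).
Hypotheses (Dt : derivation dt) (D1 : derivation d1) (D2 : derivation d2).
Hypothesis d21 : forall a, d2 (d1 a) = d1 (d2 a).
Hypothesis dt1 : forall a, dt (d1 a) = d1 (dt a).
Hypothesis dt2 : forall a, dt (d2 a) = d2 (dt a).
Variables (y1 y2 f n1 n2 n3 H K w j : A).
Hypothesis jJ : j * (d1 y1 * d2 y2 - d1 y2 * d2 y1) = 1.
Hypothesis nn : n1 ^+ 2 + n2 ^+ 2 + n3 ^+ 2 = 1.
Hypothesis nd1 : n1 * d1 y1 + n2 * d1 y2 + n3 * d1 f = 0.
Hypothesis nd2 : n1 * d2 y1 + n2 * d2 y2 + n3 * d2 f = 0.
Hypothesis flow1 : dt y1 = - ((H ^+ 2 - 2 * K) * n1).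
Hypothesis flow2 : dt y2 = - ((H ^+ 2 - 2 * K) * n2).
Hypothesis flow3 : dt f = - ((H ^+ 2 - 2 * K) * n3).
Let g := metric y1 y2 f.
Let h := sff n1 n2 n3 y1 y2 f.
Hypothesis eH : H * (g d1 d1 * g d2 d2 - g d1 d2 ^+ 2)
  = h d1 d1 * g d2 d2 - 2 * h d1 d2 * g d1 d2 + h d2 d2 * g d1 d1.
Hypothesis eK : K * (g d1 d1 * g d2 d2 - g d1 d2 ^+ 2)
  = h d1 d1 * h d2 d2 - h d1 d2 ^+ 2.
Hypothesis ew : 2 * K * w = H * (H ^+ 2 - 4 * K).
Hypotheses (n10 : ev n1 = 0) (n20 : ev n2 = 0) (n30 : ev n3 = -1).
Hypotheses (J11 : ev (d1 y1) = 1) (J12 : ev (d1 y2) = 0).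
Hypotheses (J21 : ev (d2 y1) = 0) (J22 : ev (d2 y2) = 1).
Hypotheses (h11 : 0 < ev (h d1 d1)) (h22 : 0 < ev (h d2 d2)).
Hypotheses (h12 : ev (h d1 d2) = 0) (hne : ev (h d1 d1) != ev (h d2 d2)).
Hypotheses (w1 : ev (d1 w) = 0) (w2 : ev (d2 w) = 0).
Hypotheses (w11 : ev (d1 (d1 w)) <= 0) (w22 : ev (d2 (d2 w)) <= 0).

(* [E1] and [E2] are dual to [y1] and [y2]: their components form the inverse
   of the Jacobian matrix. [Et] is [dt] corrected so as to kill [y1] and [y2] *)
Let p1 := j * d2 y2.
Let r1 := - (j * d1 y2).
Let p2 := - (j * d2 y1).
Let r2 := j * d1 y1.
Let s := - (dt y1 * p1 + dt y2 * p2).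
Let u := - (dt y1 * r1 + dt y2 * r2).
Let E1 := vfield dt d1 d2 0 p1 r1.
Let E2 := vfield dt d1 d2 0 p2 r2.
Let Et := vfield dt d1 d2 1 s u.

Let DE1 : derivation E1. Proof. exact: vfield_derivation. Qed.
Let DE2 : derivation E2. Proof. exact: vfield_derivation. Qed.
Let DEt : derivation Et. Proof. exact: vfield_derivation. Qed.

Let E1y1 : E1 y1 = 1.
Proof. by rewrite -jJ /E1 /vfield /p1 /r1; ring. Qed.
Let E1y2 : E1 y2 = 0.
Proof. by rewrite /E1 /vfield /p1 /r1; ring. Qed.
Let E2y1 : E2 y1 = 0.
Proof. by rewrite /E2 /vfield /p2 /r2; ring. Qed.
Let E2y2 : E2 y2 = 1.
Proof. by rewrite -jJ /E2 /vfield /p2 /r2; ring. Qed.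
Let EtE a : Et a = dt a - dt y1 * E1 a - dt y2 * E2 a.
Proof. by rewrite /Et /E1 /E2 /vfield /s /u; ring. Qed.
Let Ety1 : Et y1 = 0.
Proof. by rewrite EtE E1y1 E2y1; ring. Qed.
Let Ety2 : Et y2 = 0.
Proof. by rewrite EtE E1y2 E2y2; ring. Qed.

Let E21 a : E2 (E1 a) = E1 (E2 a).
Proof.
apply: (vfield_comm Dt D1 D2 d21 dt1 dt2 jJ); rewrite -/E1 -/E2.
- exact: der0.
- exact: der0.
- by rewrite E1y1 E2y1 (der1 DE2) (der0 DE1).
- by rewrite E1y2 E2y2 (der0 DE2) (der1 DE1).
Qed.

Let Et1 a : Et (E1 a) = E1 (Et a).
Proof.
apply: (vfield_comm Dt D1 D2 d21 dt1 dt2 jJ); rewrite -/E1 -/Et.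
- exact: der0.
- exact: der1.
- by rewrite E1y1 Ety1 (der1 DEt) (der0 DE1).
- by rewrite E1y2 Ety2 (der0 DEt) (der0 DE1).
Qed.

Let Et2 a : Et (E2 a) = E2 (Et a).
Proof.
apply: (vfield_comm Dt D1 D2 d21 dt1 dt2 jJ); rewrite -/E2 -/Et.
- exact: der0.
- exact: der1.
- by rewrite E2y1 Ety1 (der0 DEt) (der0 DE2).
- by rewrite E2y2 Ety2 (der1 DEt) (der0 DE2).
Qed.

Let E1E a : E1 a = p1 * d1 a + r1 * d2 a.
Proof. by rewrite /E1 /vfield mul0r add0r. Qed.
Let E2E a : E2 a = p2 * d1 a + r2 * d2 a.
Proof. by rewrite /E2 /vfield mul0r add0r. Qed.

Let n1E : n1 = - (n3 * E1 f).
Proof.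
apply/eqP; rewrite -addr_eq0; apply/eqP.
transitivity (n1 * E1 y1 + n2 * E1 y2 + n3 * E1 f).
  by rewrite E1y1 E1y2; ring.
transitivity (p1 * (n1 * d1 y1 + n2 * d1 y2 + n3 * d1 f)
              + r1 * (n1 * d2 y1 + n2 * d2 y2 + n3 * d2 f)).
  by rewrite !E1E; ring.
by rewrite nd1 nd2; ring.
Qed.

Let n2E : n2 = - (n3 * E2 f).
Proof.
apply/eqP; rewrite -addr_eq0; apply/eqP.
transitivity (n1 * E2 y1 + n2 * E2 y2 + n3 * E2 f).
  by rewrite E2y1 E2y2; ring.
transitivity (p2 * (n1 * d1 y1 + n2 * d1 y2 + n3 * d1 f)
              + r2 * (n1 * d2 y1 + n2 * d2 y2 + n3 * d2 f)).
  by rewrite !E2E; ring.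
by rewrite nd1 nd2; ring.
Qed.

Let S := 1 + E1 f ^+ 2 + E2 f ^+ 2.
(* [n3 * v = - 1] and [v ^+ 2 = S]: this is the density of the graph, found
   without a square root because the normal is given *)
Let v := - (n3 * S).

Let n3S : n3 ^+ 2 * S = 1.
Proof. by rewrite -nn n1E n2E /S; ring. Qed.

Let vn3 : v * n3 = - 1.
Proof. by rewrite -n3S /v; ring. Qed.

Let vv : v ^+ 2 = S.
Proof. by rewrite -[RHS]mul1r -n3S /v; ring. Qed.

(* the derivatives of [p'] and [r'] only meet first derivatives of the
   coordinates, which the normal kills *)
Let sff_vfield p r p' r' (F F' : A -> A) :
  (forall a, F a = p * d1 a + r * d2 a) ->
  (forall a, F' a = p' * d1 a + r' * d2 a) ->
  h F F' = p * p' * h d1 d1 + (p * r' + r * p') * h d1 d2 + r * r' * h d2 d2.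
Proof.
move=> FE F'E.
transitivity (p * p' * h d1 d1 + (p * r' + r * p') * h d1 d2 + r * r' * h d2 d2
  - F p' * (n1 * d1 y1 + n2 * d1 y2 + n3 * d1 f)
  - F r' * (n1 * d2 y1 + n2 * d2 y2 + n3 * d2 f)).
  rewrite /h /sff !F'E !FE !(derD D1, derD D2, derM D1, derM D2) !d21; ring.
by rewrite nd1 nd2 !mulr0 !subr0.
Qed.

Let metric_vfield p r p' r' (F F' : A -> A) :
  (forall a, F a = p * d1 a + r * d2 a) ->
  (forall a, F' a = p' * d1 a + r' * d2 a) ->
  g F F' = p * p' * g d1 d1 + (p * r' + r * p') * g d1 d2 + r * r' * g d2 d2.
Proof. by move=> FE F'E; rewrite /g /metric !FE !F'E; ring. Qed.

Let g11 : g E1 E1 = 1 + E1 f ^+ 2.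
Proof. by rewrite /g /metric E1y1 E1y2; ring. Qed.
Let g12 : g E1 E2 = E1 f * E2 f.
Proof. by rewrite /g /metric E1y1 E1y2 E2y1 E2y2; ring. Qed.
Let g22 : g E2 E2 = 1 + E2 f ^+ 2.
Proof. by rewrite /g /metric E2y1 E2y2; ring. Qed.

Let hE11 : v * h E1 E1 = E1 (E1 f).
Proof.
rewrite /h /sff E1y1 E1y2 (der0 DE1) (der1 DE1).
by transitivity (- (v * n3) * E1 (E1 f)); [ring|rewrite vn3; ring].
Qed.
Let hE12 : v * h E1 E2 = E1 (E2 f).
Proof.
rewrite /h /sff E2y1 E2y2 (der0 DE1) (der1 DE1).
by transitivity (- (v * n3) * E1 (E2 f)); [ring|rewrite vn3; ring].
Qed.
Let hE22 : v * h E2 E2 = E2 (E2 f).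
Proof.
rewrite /h /sff E2y1 E2y2 (der0 DE2) (der1 DE2).
by transitivity (- (v * n3) * E2 (E2 f)); [ring|rewrite vn3; ring].
Qed.

Let detgE : g E1 E1 * g E2 E2 - g E1 E2 ^+ 2
  = (p1 * r2 - r1 * p2) ^+ 2 * (g d1 d1 * g d2 d2 - g d1 d2 ^+ 2).
Proof.
by rewrite (metric_vfield E1E E1E) (metric_vfield E1E E2E)
  (metric_vfield E2E E2E); ring.
Qed.

Let detgv : g E1 E1 * g E2 E2 - g E1 E2 ^+ 2 = v ^+ 2.
Proof. by rewrite g11 g12 g22 vv /S; ring. Qed.

Let eHE : H * v ^+ 2
  = h E1 E1 * g E2 E2 - 2 * h E1 E2 * g E1 E2 + h E2 E2 * g E1 E1.
Proof.
rewrite -detgv detgE mulrCA eH.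
rewrite (metric_vfield E1E E1E) (metric_vfield E1E E2E) (metric_vfield E2E E2E).
by rewrite (sff_vfield E1E E1E) (sff_vfield E1E E2E) (sff_vfield E2E E2E); ring.
Qed.

Let eKE : K * v ^+ 2 = h E1 E1 * h E2 E2 - h E1 E2 ^+ 2.
Proof.
rewrite -detgv detgE mulrCA eK.
by rewrite (sff_vfield E1E E1E) (sff_vfield E1E E2E) (sff_vfield E2E E2E); ring.
Qed.

Let j0 : ev j = 1.
Proof.
have := congr1 ev jJ; rewrite !evE J11 J12 J21 J22 => e.
by apply: (eq_of_sub_eq e); ring.
Qed.

Let evp1 : ev p1 = 1. Proof. by rewrite rmorphM j0 J22 mulr1. Qed.
Let evr1 : ev r1 = 0. Proof. by rewrite rmorphN rmorphM J12 mulr0 oppr0. Qed.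
Let evp2 : ev p2 = 0. Proof. by rewrite rmorphN rmorphM J21 mulr0 oppr0. Qed.
Let evr2 : ev r2 = 1. Proof. by rewrite rmorphM j0 J11 mulr1. Qed.

Let evE1 a : ev (E1 a) = ev (d1 a).
Proof.
rewrite E1E; move: evp1 evr1; generalize p1 r1 => p r ep er.
by rewrite !evE ep er; ring.
Qed.
Let evE2 a : ev (E2 a) = ev (d2 a).
Proof.
rewrite E2E; move: evp2 evr2; generalize p2 r2 => p r ep er.
by rewrite !evE ep er; ring.
Qed.

Let f1 : ev (E1 f) = 0.
Proof.
have := congr1 ev n1E; rewrite !evE n10 n30 => e.
by apply: (eq_of_sub_eq (esym e)); ring.
Qed.
Let f2 : ev (E2 f) = 0.
Proof.
have := congr1 ev n2E; rewrite !evE n20 n30 => e.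
by apply: (eq_of_sub_eq (esym e)); ring.
Qed.
Let v0 : ev v = 1.
Proof.
rewrite /v /S; move: f1 f2; generalize (E1 f) (E2 f) => a b ea eb.
by rewrite !evE ea eb n30; ring.
Qed.

(** The two curvatures are ratios of determinants which all change by the same
    factor under a change of tangent fields, so [E1] and [E2] can replace [d1]
    and [d2] in their equations, and [graph_max_principle] applies. The two
    pairs agree at the point, and there the first derivatives of [w] vanish, so
    the conditions on [w] are the same for both pairs. *)
Lemma param_max_principle : ev (dt w) <= 0.
Proof.
have <- : ev (Et w) = ev (dt w).
  rewrite EtE; have := evE1 w; have := evE2 w; rewrite w1 w2.
  generalize (E1 w) (E2 w) => a b ea eb.
  by rewrite !evE ea eb; ring.
have e11 : ev (E1 (E1 f)) = ev (h d1 d1).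
  rewrite -hE11 (sff_vfield E1E E1E); move: v0 evp1 evr1.
  generalize v p1 r1 (h d1 d1) (h d1 d2) (h d2 d2) => v' p r a b c ev' ep er.
  by rewrite !evE ev' ep er; ring.
have e12 : ev (E1 (E2 f)) = ev (h d1 d2).
  rewrite -hE12 (sff_vfield E1E E2E); move: v0 evp1 evr1 evp2 evr2.
  generalize v p1 r1 p2 r2 (h d1 d1) (h d1 d2) (h d2 d2).
  move=> v' p r p' r' a b c ev' ep er ep' er'.
  by rewrite !evE ev' ep er ep' er'; ring.
have e22 : ev (E2 (E2 f)) = ev (h d2 d2).
  rewrite -hE22 (sff_vfield E2E E2E); move: v0 evp2 evr2.
  generalize v p2 r2 (h d1 d1) (h d1 d2) (h d2 d2) => v' p r a b c ev' ep er.
  by rewrite !evE ev' ep er; ring.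
apply: (graph_max_principle DE1 DE2 DEt E21 Et1 Et2 vv _ _ ew _ f1 f2 v0).
- transitivity (v * (H * v ^+ 2)); first by ring.
  by rewrite eHE -hE11 -hE12 -hE22 g11 g12 g22; ring.
- transitivity (v ^+ 2 * (K * v ^+ 2)); first by ring.
  by rewrite eKE -hE11 -hE12 -hE22; ring.
- rewrite EtE flow1 flow2 flow3 n1E n2E /v /S; ring.
- by rewrite e12.
- by rewrite e11.
- by rewrite e22.
- by rewrite e11 e22.
- by rewrite evE1.
- by rewrite evE2.
- rewrite evE1 E1E; move: evp1 evr1; generalize p1 r1 => p r ep er.
  rewrite (derD D1) !(derM D1) !evE w1 w2 ep er.
  by rewrite !(mulr0, mul0r, mul1r, addr0, add0r).
- rewrite evE2 E2E; move: evp2 evr2; generalize p2 r2 => p r ep er.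
  rewrite (derD D2) !(derM D2) !evE w1 w2 ep er.
  by rewrite !(mulr0, mul0r, mul1r, addr0, add0r).
Qed.

End GraphGauge.

(** * Frames adapted to a point *)

Lemma orthonormal_columns (R : comUnitRingType) (x1 x2 x3 y1 y2 y3 z1 z2 z3 : R) :
  x1 ^+ 2 + x2 ^+ 2 + x3 ^+ 2 = 1 -> y1 ^+ 2 + y2 ^+ 2 + y3 ^+ 2 = 1 ->
  z1 ^+ 2 + z2 ^+ 2 + z3 ^+ 2 = 1 ->
  x1 * y1 + x2 * y2 + x3 * y3 = 0 -> x1 * z1 + x2 * z2 + x3 * z3 = 0 ->
  y1 * z1 + y2 * z2 + y3 * z3 = 0 ->
  [/\ x1 ^+ 2 + y1 ^+ 2 + z1 ^+ 2 = 1, x2 ^+ 2 + y2 ^+ 2 + z2 ^+ 2 = 1 &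
      x3 ^+ 2 + y3 ^+ 2 + z3 ^+ 2 = 1] /\
  [/\ x1 * x2 + y1 * y2 + z1 * z2 = 0, x1 * x3 + y1 * y3 + z1 * z3 = 0 &
      x2 * x3 + y2 * y3 + z2 * z3 = 0].
Proof.
move=> xx yy zz xy xz yz.
pose M : 'M[R]_3 := \matrix_(i, j)
  nth 0 (nth [::] [:: [:: x1; x2; x3]; [:: y1; y2; y3]; [:: z1; z2; z3]] i) j.
have MM : M *m M^T = 1%:M.
  apply/matrixP => i j; rewrite !mxE !big_ord_recl big_ord0 !mxE /= addr0.
  by case: i => [[|[|[|]]]] // ?; case: j => [[|[|[|]]]] // ?;
    rewrite /= ?mulr1n ?mulr0n addrA -?expr2 // 1?(mulrC y1) 1?(mulrC y2)
      1?(mulrC y3) 1?(mulrC z1) 1?(mulrC z2) 1?(mulrC z3).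
have /matrixP NN := mulmx1C MM.
have E (i j : 'I_3) := NN i j.
have e i j (hi : (i < 3)%N) (hj : (j < 3)%N) := E (Ordinal hi) (Ordinal hj).
split; split; [move: (e 0%N 0%N isT isT)|move: (e 1%N 1%N isT isT)
  |move: (e 2%N 2%N isT isT)|move: (e 0%N 1%N isT isT)
  |move: (e 0%N 2%N isT isT)|move: (e 1%N 2%N isT isT)];
  rewrite !mxE !big_ord_recl big_ord0 !mxE /= ?mulr1n ?mulr0n addr0 => <-;
  by ring.
Qed.

(** The parametrization [(f0, f1, f2)] and its normal [(n0, n1, n2)] are given
    in arbitrary axes, with coordinate derivations [p0], [p1]. The constant
    combinations [d1] and [d2] of [p0] and [p1] diagonalize both fundamental
    forms at the point; the constants of the ring are the image of [k]. *)
Section Frame.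
Variables (R : realFieldType) (A : comNzRingType) (ev : {rmorphism A -> R}).
Variable k : {rmorphism R -> A}.
Hypothesis evk : forall r, ev (k r) = r.
Variables (p0 p1 pt : A -> A).
Hypotheses (D0 : derivation p0) (D1 : derivation p1) (Dt : derivation pt).
Hypothesis p10 : forall a, p1 (p0 a) = p0 (p1 a).
Hypothesis pt0 : forall a, pt (p0 a) = p0 (pt a).
Hypothesis pt1 : forall a, pt (p1 a) = p1 (pt a).
Hypotheses (k0 : forall r, p0 (k r) = 0) (k1 : forall r, p1 (k r) = 0).
Hypothesis kt : forall r, pt (k r) = 0.
Variables (f0 f1 f2 n0 n1 n2 H K w : A).
Hypothesis nn : n0 ^+ 2 + n1 ^+ 2 + n2 ^+ 2 = 1.
Hypothesis nd0 : n0 * p0 f0 + n1 * p0 f1 + n2 * p0 f2 = 0.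
Hypothesis nd1 : n0 * p1 f0 + n1 * p1 f1 + n2 * p1 f2 = 0.
Hypothesis flow0 : pt f0 = - ((H ^+ 2 - 2 * K) * n0).
Hypothesis flow1 : pt f1 = - ((H ^+ 2 - 2 * K) * n1).
Hypothesis flow2 : pt f2 = - ((H ^+ 2 - 2 * K) * n2).
Let g := metric f0 f1 f2.
Let h := sff n0 n1 n2 f0 f1 f2.
Hypothesis eH : H * (g p0 p0 * g p1 p1 - g p0 p1 ^+ 2)
  = h p0 p0 * g p1 p1 - 2 * h p0 p1 * g p0 p1 + h p1 p1 * g p0 p0.
Hypothesis eK : K * (g p0 p0 * g p1 p1 - g p0 p1 ^+ 2)
  = h p0 p0 * h p1 p1 - h p0 p1 ^+ 2.
Hypothesis ew : 2 * K * w = H * (H ^+ 2 - 4 * K).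
Variables a1 b1 a2 b2 : R.

Definition cst_field (a b : R) (z : A) : A := k a * p0 z + k b * p1 z.

Let d1 := cst_field a1 b1.
Let d2 := cst_field a2 b2.
Hypotheses (g11 : ev (g d1 d1) = 1) (g12 : ev (g d1 d2) = 0).
Hypotheses (g22 : ev (g d2 d2) = 1) (h12 : ev (h d1 d2) = 0).
Definition dot_cst (x1 x2 x3 : R) (z1 z2 z3 : A) : A :=
  k x1 * z1 + k x2 * z2 + k x3 * z3.
(* at the point, the tangent vectors along [d1] and [d2] and the opposite of
   the normal form an orthonormal frame, which gives the new axes *)
Let r1 := dot_cst (ev (d1 f0)) (ev (d1 f1)) (ev (d1 f2)).
Let r2 := dot_cst (ev (d2 f0)) (ev (d2 f1)) (ev (d2 f2)).
Let r3 := dot_cst (- ev n0) (- ev n1) (- ev n2).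
Variable j : A.
Hypothesis jJ : j * (d1 (r1 f0 f1 f2) * d2 (r2 f0 f1 f2)
                     - d1 (r2 f0 f1 f2) * d2 (r1 f0 f1 f2)) = 1.
Hypotheses (H0 : 0 < ev H) (K0 : 0 < ev K) (w0 : ev w != 0).
Hypotheses (w1 : ev (d1 w) = 0) (w2 : ev (d2 w) = 0).
Hypotheses (w11 : ev (d1 (d1 w)) <= 0) (w22 : ev (d2 (d2 w)) <= 0).

Lemma cst_field_derivation a b : derivation (cst_field a b).
Proof.
split=> x y; rewrite /cst_field.
  by rewrite !(derD D0, derD D1); ring.
by rewrite !(derM D0, derM D1); ring.
Qed.

Let DD1 : derivation d1 := cst_field_derivation a1 b1.
Let DD2 : derivation d2 := cst_field_derivation a2 b2.

Let d21 a : d2 (d1 a) = d1 (d2 a).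
Proof.
rewrite /d1 /d2 /cst_field !(derD D0, derD D1, derM D0, derM D1) !(k0, k1) !p10.
by ring.
Qed.
Let dt1 a : pt (d1 a) = d1 (pt a).
Proof. by rewrite /d1 /cst_field !(derD Dt, derM Dt) !kt !pt0 !pt1; ring. Qed.
Let dt2 a : pt (d2 a) = d2 (pt a).
Proof. by rewrite /d2 /cst_field !(derD Dt, derM Dt) !kt !pt0 !pt1; ring. Qed.

Let dk a b r : cst_field a b (k r) = 0.
Proof. by rewrite /cst_field k0 k1; ring. Qed.

Lemma der_dot_cst d x1 x2 x3 z1 z2 z3 : derivation d ->
  (forall r, d (k r) = 0) ->
  d (dot_cst x1 x2 x3 z1 z2 z3) = dot_cst x1 x2 x3 (d z1) (d z2) (d z3).
Proof. by move=> D dk0; rewrite /dot_cst !(derD D, derM D) !dk0; ring. Qed.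

Lemma ev_dot_cst x1 x2 x3 z1 z2 z3 :
  ev (dot_cst x1 x2 x3 z1 z2 z3) = x1 * ev z1 + x2 * ev z2 + x3 * ev z3.
Proof. by rewrite /dot_cst !(rmorphD ev, rmorphM ev) !evk. Qed.

Let nd a b : n0 * cst_field a b f0 + n1 * cst_field a b f1 + n2 * cst_field a b f2 = 0.
Proof.
transitivity (k a * (n0 * p0 f0 + n1 * p0 f1 + n2 * p0 f2)
  + k b * (n0 * p1 f0 + n1 * p1 f1 + n2 * p1 f2)).
  by rewrite /cst_field; ring.
by rewrite nd0 nd1; ring.
Qed.

Lemma metric_cst_field a b a' b' : g (cst_field a b) (cst_field a' b')
  = k a * k a' * g p0 p0 + (k a * k b' + k b * k a') * g p0 p1
    + k b * k b' * g p1 p1.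
Proof. by rewrite /g /metric /cst_field; ring. Qed.

Lemma sff_cst_field a b a' b' : h (cst_field a b) (cst_field a' b')
  = k a * k a' * h p0 p0 + (k a * k b' + k b * k a') * h p0 p1
    + k b * k b' * h p1 p1.
Proof.
rewrite /h /sff /cst_field !(derD D0, derD D1, derM D0, derM D1) !(k0, k1) !p10.
by ring.
Qed.

Let frame := @orthonormal_columns R
  (ev (d1 f0)) (ev (d1 f1)) (ev (d1 f2)) (ev (d2 f0)) (ev (d2 f1)) (ev (d2 f2))
  (- ev n0) (- ev n1) (- ev n2).

Lemma rotation_isometry (a0 c1 c2 z0 z1 z2 : A) :
  r1 a0 c1 c2 * r1 z0 z1 z2 + r2 a0 c1 c2 * r2 z0 z1 z2
    + r3 a0 c1 c2 * r3 z0 z1 z2 = a0 * z0 + c1 * z1 + c2 * z2.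
Proof.
have [||||||] := frame.
- by rewrite -g11 /g /metric !(rmorphD ev, rmorphM ev) !expr2.
- by rewrite -g22 /g /metric !(rmorphD ev, rmorphM ev) !expr2.
- by rewrite -[RHS](rmorph1 ev) -nn !(rmorphD ev, rmorphXn ev) !sqrrN.
- by rewrite -g12 /g /metric !(rmorphD ev, rmorphM ev).
- have := congr1 ev (nd a1 b1); rewrite -/d1 !(rmorphD ev, rmorphM ev) rmorph0.
  by move=> e; apply: (eq_of_sub_eq (esym e)); ring.
- have := congr1 ev (nd a2 b2); rewrite -/d2 !(rmorphD ev, rmorphM ev) rmorph0.
  by move=> e; apply: (eq_of_sub_eq (esym e)); ring.
rewrite /r1 /r2 /r3 /dot_cst.
generalize (ev (d1 f0)) (ev (d1 f1)) (ev (d1 f2)) (ev (d2 f0)) (ev (d2 f1))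
  (ev (d2 f2)) (- ev n0) (- ev n1) (- ev n2).
move=> x1 x2 x3 y1 y2 y3 u1 u2 u3 [+ + +] [+ + +].
move=> /(congr1 k) + /(congr1 k) + /(congr1 k) + /(congr1 k) + /(congr1 k) +
  /(congr1 k).
rewrite !(rmorphD k, rmorphXn k, rmorphM k) rmorph1 rmorph0.
move: (k x1) (k x2) (k x3) (k y1) (k y2) (k y3) (k u1) (k u2) (k u3).
move=> {}x1 {}x2 {}x3 {}y1 {}y2 {}y3 {}u1 {}u2 {}u3 e1 e2 e3 e12 e13 e23.
transitivity ((x1 ^+ 2 + y1 ^+ 2 + u1 ^+ 2) * (a0 * z0)
  + (x2 ^+ 2 + y2 ^+ 2 + u2 ^+ 2) * (c1 * z1)
  + (x3 ^+ 2 + y3 ^+ 2 + u3 ^+ 2) * (c2 * z2)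
  + (x1 * x2 + y1 * y2 + u1 * u2) * (a0 * z1 + c1 * z0)
  + (x1 * x3 + y1 * y3 + u1 * u3) * (a0 * z2 + c2 * z0)
  + (x2 * x3 + y2 * y3 + u2 * u3) * (c1 * z2 + c2 * z1)); first by ring.
by rewrite e1 e2 e3 e12 e13 e23; ring.
Qed.

Let y1 := r1 f0 f1 f2.
Let y2 := r2 f0 f1 f2.
Let y3 := r3 f0 f1 f2.
Let m1 := r1 n0 n1 n2.
Let m2 := r2 n0 n1 n2.
Let m3 := r3 n0 n1 n2.

Let metric_rotated d d' : derivation d -> (forall r, d (k r) = 0) ->
  derivation d' -> (forall r, d' (k r) = 0) -> metric y1 y2 y3 d d' = g d d'.
Proof.
move=> D dk0 D' dk0'; rewrite /metric /y1 /y2 /y3 /r1 /r2 /r3.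
rewrite !(der_dot_cst _ _ _ _ _ _ D dk0, der_dot_cst _ _ _ _ _ _ D' dk0').
by rewrite -/r1 -/r2 -/r3 rotation_isometry.
Qed.

Let sff_rotated d d' : derivation d -> (forall r, d (k r) = 0) ->
  derivation d' -> (forall r, d' (k r) = 0) ->
  sff m1 m2 m3 y1 y2 y3 d d' = h d d'.
Proof.
move=> D dk0 D' dk0'; rewrite /sff /y1 /y2 /y3 /m1 /m2 /m3 /r1 /r2 /r3.
rewrite !(der_dot_cst _ _ _ _ _ _ D dk0, der_dot_cst _ _ _ _ _ _ D' dk0').
by rewrite -/r1 -/r2 -/r3 rotation_isometry.
Qed.

Let detgE : g d1 d1 * g d2 d2 - g d1 d2 ^+ 2
  = (k a1 * k b2 - k b1 * k a2) ^+ 2 * (g p0 p0 * g p1 p1 - g p0 p1 ^+ 2).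
Proof. by rewrite /d1 /d2 !metric_cst_field; ring. Qed.

Let eHd : H * (g d1 d1 * g d2 d2 - g d1 d2 ^+ 2)
  = h d1 d1 * g d2 d2 - 2 * h d1 d2 * g d1 d2 + h d2 d2 * g d1 d1.
Proof. by rewrite detgE mulrCA eH /d1 /d2 !metric_cst_field !sff_cst_field; ring. Qed.

Let eKd : K * (g d1 d1 * g d2 d2 - g d1 d2 ^+ 2)
  = h d1 d1 * h d2 d2 - h d1 d2 ^+ 2.
Proof. by rewrite detgE mulrCA eK /d1 /d2 !sff_cst_field; ring. Qed.

Let flow_rotated x1 x2 x3 : pt (dot_cst x1 x2 x3 f0 f1 f2)
  = - ((H ^+ 2 - 2 * K) * dot_cst x1 x2 x3 n0 n1 n2).
Proof. by rewrite der_dot_cst// flow0 flow1 flow2 /dot_cst; ring. Qed.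

Let ev3 (x y z x' y' z' : A) : ev (x * x' + y * y' + z * z')
  = ev x * ev x' + ev y * ev y' + ev z * ev z'.
Proof. by rewrite !(rmorphD ev, rmorphM ev). Qed.

(** Both fundamental forms are invariant under the rotation to the new axes, so
    [param_max_principle] applies. The principal curvatures at the point are
    positive because their sum and product are, and they differ because
    [w] is not zero. *)
Lemma frame_max_principle : ev (pt w) <= 0.
Proof.
have eh : ev H = ev (h d1 d1) + ev (h d2 d2).
  have := congr1 ev eHd; move: g11 g22 g12 h12.
  generalize (g d1 d1) (g d1 d2) (g d2 d2) (h d1 d1) (h d1 d2) (h d2 d2).
  move=> G11 G12 G22 h11' h12' h22' e1 e2 e3 e4.
  rewrite !(rmorphM ev, rmorphB ev, rmorphD ev, rmorphXn ev) e1 e2 e3 e4.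
  by move=> e; apply: (eq_of_sub_eq e); ring.
have ek : ev K = ev (h d1 d1) * ev (h d2 d2).
  have := congr1 ev eKd; move: g11 g22 g12 h12.
  generalize (g d1 d1) (g d1 d2) (g d2 d2) (h d1 d1) (h d1 d2) (h d2 d2).
  move=> G11 G12 G22 h11' h12' h22' e1 e2 e3 e4.
  rewrite !(rmorphM ev, rmorphB ev, rmorphD ev, rmorphXn ev) e1 e2 e3 e4.
  by move=> e; apply: (eq_of_sub_eq e); ring.
have nd1' := congr1 ev (nd a1 b1); rewrite -/d1 in nd1'.
have nd2' := congr1 ev (nd a2 b2); rewrite -/d2 in nd2'.
rewrite ev3 rmorph0 in nd1'; rewrite ev3 rmorph0 in nd2'.
have nn' := congr1 ev nn; rewrite !(rmorphD ev, rmorphXn ev) rmorph1 in nn'.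
have gE11 := g11; rewrite /g /metric ev3 in gE11.
have gE12 := g12; rewrite /g /metric ev3 in gE12.
have gE22 := g22; rewrite /g /metric ev3 in gE22.
have hpos : 0 < ev (h d1 d1) /\ 0 < ev (h d2 d2).
  move: H0 K0; rewrite eh ek; generalize (ev (h d1 d1)) (ev (h d2 d2)) => x y s p.
  have [x0|x0] := ltP 0 x; first by split=> //; rewrite -(pmulr_rgt0 _ x0).
  have y0 : 0 < y by lra.
  by exfalso; move: p; rewrite pmulr_lgt0// ltNge x0.
have hne : ev (h d1 d1) != ev (h d2 d2).
  apply: contra_neq w0 => hh; have := congr1 ev ew.
  have Kn0 : 2 * ev K != 0 by rewrite mulf_neq0 ?pnatr_eq0// gt_eqF.
  rewrite !(rmorphM ev, rmorphB ev, rmorphXn ev) !rmorph_nat => e.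
  by apply: (mulfI Kn0); rewrite e eh ek hh mulr0; ring.
case: hpos => hp1 hp2.
have K1 := dk a1 b1; have K2 := dk a2 b2; rewrite -/d1 in K1; rewrite -/d2 in K2.
have M11 := metric_rotated DD1 K1 DD1 K1.
have M12 := metric_rotated DD1 K1 DD2 K2.
have M22 := metric_rotated DD2 K2 DD2 K2.
have S11 := sff_rotated DD1 K1 DD1 K1.
have S12 := sff_rotated DD1 K1 DD2 K2.
have S22 := sff_rotated DD2 K2 DD2 K2.
apply: (@param_max_principle R A ev d1 d2 pt Dt DD1 DD2 d21 dt1 dt2
  y1 y2 y3 m1 m2 m3 H K w j jJ) => //.
- by rewrite !expr2 rotation_isometry -!expr2.
- rewrite /y1 /y2 /y3 /r1 /r2 /r3 !(der_dot_cst _ _ _ _ _ _ DD1 (dk a1 b1)).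
  by rewrite -/r1 -/r2 -/r3 rotation_isometry nd.
- rewrite /y1 /y2 /y3 /r1 /r2 /r3 !(der_dot_cst _ _ _ _ _ _ DD2 (dk a2 b2)).
  by rewrite -/r1 -/r2 -/r3 rotation_isometry nd.
- exact: flow_rotated.
- exact: flow_rotated.
- exact: flow_rotated.
- by rewrite M11 M12 M22 S11 S12 S22; exact: eHd.
- by rewrite M11 M12 M22 S11 S12 S22; exact: eKd.
- by rewrite ev_dot_cst; apply: (eq_of_sub_eq nd1'); ring.
- by rewrite ev_dot_cst; apply: (eq_of_sub_eq nd2'); ring.
- rewrite ev_dot_cst; apply: (eq_of_sub_eq (esym nn')); ring.
- rewrite /y1 /r1 (der_dot_cst _ _ _ _ _ _ DD1 (dk a1 b1)) ev_dot_cst.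
  exact: gE11.
- rewrite /y2 /r2 (der_dot_cst _ _ _ _ _ _ DD1 (dk a1 b1)) ev_dot_cst.
  by apply: (eq_of_sub_eq gE12); ring.
- rewrite /y1 /r1 (der_dot_cst _ _ _ _ _ _ DD2 (dk a2 b2)) ev_dot_cst.
  exact: gE12.
- rewrite /y2 /r2 (der_dot_cst _ _ _ _ _ _ DD2 (dk a2 b2)) ev_dot_cst.
  exact: gE22.
- by rewrite S11.
- by rewrite S22.
- by rewrite S12.
- by rewrite S11 S22.
Qed.

End Frame.

(** * Pairs of symmetric forms in dimension two *)

Section SimultaneousDiagonalization.
Variable R : rcfType.

Lemma diagonalizing_rotation (p q r : R) : exists c s : R,
  c ^+ 2 + s ^+ 2 = 1 /\ c * s * (r - p) + (c ^+ 2 - s ^+ 2) * q = 0.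
Proof.
have [->|q0] := eqVneq q 0.
  by exists 1, 0; split; ring.
pose D := Num.sqrt ((p - r) ^+ 2 + 4 * q ^+ 2).
have D2 : D ^+ 2 = (p - r) ^+ 2 + 4 * q ^+ 2.
  by rewrite sqr_sqrtr// addr_ge0 ?sqr_ge0// mulr_ge0// sqr_ge0.
(* the larger eigenvalue minus [r]; then [(m, q)] is an eigenvector *)
pose m := (p - r + D) / 2.
have em : m ^+ 2 - (p - r) * m - q ^+ 2 = 0.
  transitivity ((D ^+ 2 - ((p - r) ^+ 2 + 4 * q ^+ 2)) / 4).
    by rewrite /m; field.
  by rewrite D2 subrr mul0r.
clearbody m.
have n0 : 0 < m ^+ 2 + q ^+ 2.
  by rewrite ltr_wpDl ?sqr_ge0// lt_neqAle sqr_ge0 eq_sym sqrf_eq0 q0.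
pose n := Num.sqrt (m ^+ 2 + q ^+ 2).
have nn0 : n != 0 by rewrite gt_eqF// sqrtr_gt0.
have n2 : n ^+ 2 = m ^+ 2 + q ^+ 2 by rewrite sqr_sqrtr// ltW.
exists (m / n), (q / n); split.
  by rewrite !expr_div_n -mulrDl -n2 divff// expf_neq0.
transitivity (q * (m ^+ 2 - (p - r) * m - q ^+ 2) / n ^+ 2); first by field.
by rewrite em mulr0 mul0r.
Qed.

Definition sym_bil (x y z a b a' b' : R) : R :=
  a * a' * x + (a * b' + b * a') * y + b * b' * z.

(** Gram-Schmidt for the positive form, followed by a rotation which
    diagonalizes the second one. *)
Lemma simultaneous_diagonalization (g11 g12 g22 h11 h12 h22 : R) :
  0 < g11 -> 0 < g11 * g22 - g12 ^+ 2 ->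
  exists a1 b1 a2 b2 : R,
  [/\ sym_bil g11 g12 g22 a1 b1 a1 b1 = 1, sym_bil g11 g12 g22 a1 b1 a2 b2 = 0,
      sym_bil g11 g12 g22 a2 b2 a2 b2 = 1 & sym_bil h11 h12 h22 a1 b1 a2 b2 = 0].
Proof.
move=> g0 d0.
pose s1 := Num.sqrt g11; pose s2 := Num.sqrt (g11 * (g11 * g22 - g12 ^+ 2)).
have e1 : s1 ^+ 2 = g11 by rewrite sqr_sqrtr// ltW.
have e2 : s2 ^+ 2 = g11 * (g11 * g22 - g12 ^+ 2).
  by rewrite sqr_sqrtr// ltW// mulr_gt0.
have n1 : s1 != 0 by rewrite gt_eqF// sqrtr_gt0.
have n2 : s2 != 0 by rewrite gt_eqF// sqrtr_gt0 mulr_gt0.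
pose x1 := s1^-1; pose x2 := - g12 / s2; pose y2 := g11 / s2.
have G11 : sym_bil g11 g12 g22 x1 0 x1 0 = 1.
  transitivity (g11 / s1 ^+ 2); first by rewrite /sym_bil /x1; field.
  by rewrite e1 divff// gt_eqF.
have G12 : sym_bil g11 g12 g22 x1 0 x2 y2 = 0.
  by rewrite /sym_bil /x1 /x2 /y2; field; rewrite n1 n2.
have G22 : sym_bil g11 g12 g22 x2 y2 x2 y2 = 1.
  transitivity (g11 * (g11 * g22 - g12 ^+ 2) / s2 ^+ 2).
    by rewrite /sym_bil /x2 /y2; field.
  by rewrite -e2 divff// expf_neq0.
have [c [s [cs E]]] := diagonalizing_rotation (sym_bil h11 h12 h22 x1 0 x1 0)
  (sym_bil h11 h12 h22 x1 0 x2 y2) (sym_bil h11 h12 h22 x2 y2 x2 y2).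
exists (c * x1 + s * x2), (s * y2), (- s * x1 + c * x2), (c * y2).
move: x1 x2 y2 G11 G12 G22 E => x1 x2 y2 G11 G12 G22 E; split.
- transitivity (c ^+ 2 * sym_bil g11 g12 g22 x1 0 x1 0
    + 2 * c * s * sym_bil g11 g12 g22 x1 0 x2 y2
    + s ^+ 2 * sym_bil g11 g12 g22 x2 y2 x2 y2); first by rewrite /sym_bil; ring.
  by rewrite G11 G12 G22 -[RHS]cs; ring.
- transitivity (c * s * (sym_bil g11 g12 g22 x2 y2 x2 y2
      - sym_bil g11 g12 g22 x1 0 x1 0)
    + (c ^+ 2 - s ^+ 2) * sym_bil g11 g12 g22 x1 0 x2 y2).
    by rewrite /sym_bil; ring.
  by rewrite G11 G12 G22; ring.
- transitivity (s ^+ 2 * sym_bil g11 g12 g22 x1 0 x1 0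
    - 2 * c * s * sym_bil g11 g12 g22 x1 0 x2 y2
    + c ^+ 2 * sym_bil g11 g12 g22 x2 y2 x2 y2); first by rewrite /sym_bil; ring.
  by rewrite G11 G12 G22 -[RHS]cs; ring.
- by rewrite -[RHS]E /sym_bil; ring.
Qed.

End SimultaneousDiagonalization.

Lemma det_mx22 (R : comRingType) (M : 'M[R]_2) :
  \det M = M 0 0 * M 1 1 - M 0 1 * M 1 0.
Proof.
rewrite (expand_det_row _ 0) !big_ord_recl big_ord0 addr0 /cofactor !det_mx11.
rewrite !mxE /= expr0 mul1r expr1 mulN1r mulrN.
by congr (M _ _ * M _ _ - M _ _ * M _ _); apply: val_inj.
Qed.

(** The trace and the determinant of [h *m invmx g], cleared of
    denominators. *)
Lemma char_poly2_roots (R : fieldType) (g h : 'M[R]_2) (l1 l2 : R) :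
  g \in unitmx ->
  char_poly (h *m invmx g) = ('X - l1%:P) * ('X - l2%:P) ->
  (l1 + l2) * (g 0 0 * g 1 1 - g 0 1 * g 1 0)
    = h 0 0 * g 1 1 - h 0 1 * g 1 0 - h 1 0 * g 0 1 + h 1 1 * g 0 0
  /\ l1 * l2 * (g 0 0 * g 1 1 - g 0 1 * g 1 0) = h 0 0 * h 1 1 - h 0 1 * h 1 0.
Proof.
move=> gu cp; set M := h *m invmx g in cp.
have hM : h = M *m g by rewrite /M mulmxKV.
have E : ('X - l1%:P) * ('X - l2%:P)
  = 'X * 'X - (l1 + l2) *: 'X + (l1 * l2)%:P :> {poly R}.
  by rewrite -mul_polyC polyCD polyCM; ring.
have t : l1 + l2 = M 0 0 + M 1 1.
  have := char_poly_trace M isT.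
  rewrite cp E !coefD coefN coefZ coefC coefX /= -expr2 coefXn /= mulr1 add0r addr0.
  by move/oppr_inj => ->; rewrite /mxtrace !big_ord_recl big_ord0 addr0;
    congr (M _ _ + M _ _); apply: val_inj.
have d : l1 * l2 = M 0 0 * M 1 1 - M 0 1 * M 1 0.
  have := char_poly_det M.
  rewrite cp E !coefD coefN coefZ coefC coefX /= -expr2 coefXn /= mulr0 oppr0 !add0r.
  by rewrite sqrrN expr1n mul1r => ->; rewrite det_mx22.
have e (i k : 'I_2) : h i k = M i 0 * g 0 k + M i 1 * g 1 k.
  rewrite hM mxE !big_ord_recl big_ord0 addr0.
  by congr (M _ _ * g _ _ + M _ _ * g _ _); apply: val_inj.
by rewrite t d !e; split; ring.
Qed.

(** * Second derivatives *)

Section Locality.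
Context {R : realType} {V W : normedModType R}.

(** The difference of the two functions is zero near [x], so it has the zero
    map as differential there. *)
Lemma near_eq_differentiable (f g : V -> W) (x : V) :
  {near x, f =1 g} -> differentiable f x -> differentiable g x.
Proof.
move=> fg df.
have -> : g = f + (g - f) by rewrite addrC subrK.
apply: differentiableD; first exact: df.
set e := g - f.
have e0 : \forall y \near x, e y = 0.
  by apply: filterS fg => y /= fgy; rewrite /e !fctE fgy subrr.
have ex0 : e x = 0 by exact: nbhs_singleton e0.
have E : e \o shift x = cst (e x) + (\0 : V -> W) +o_ 0 id.
  apply/eqaddoE; rewrite ex0 funeqE => y /=; rewrite !fctE /= !add0r.
  rewrite littleoE//; last first.
  move=> _/posnumP[eps]; near=> z.
  rewrite /= (_ : e (z + x) = 0) ?normr0 ?mulr_ge0//.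
  near: z.
  move: e0; rewrite (near_shift 0) /=.
  by apply: filterS => z; rewrite /= subr0.
have dE : 'd e x = (\0 : V -> W) :> (V -> W).
  by apply: diff_unique => //; exact: cst_continuous.
by apply/diff_locallyP; rewrite dE; split=> //; exact: cst_continuous.
Unshelve. all: by end_near. Qed.

Lemma differentiable_bound (f : V -> W) (x : V) : differentiable f x ->
  forall e, 0 < e -> \forall k \near (0 : V),
    `|f (k + x) - f x - 'd f x k| <= e * `|k|.
Proof.
move=> /diff_locally; set r := 'o _ => df e e0.
near=> k; have -> : f (k + x) = f x + 'd f x k + r k.
  exact: (congr1 (fun F => F k) df).
rewrite (_ : _ - _ = r k); last first.
  by rewrite -[LHS]addrA -opprD addrAC subrr add0r.
by near: k; exact: (littleoP [littleo of r]).
Unshelve. all: by end_near. Qed.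

Lemma differentiable_line (f : V -> W) (x v : V) (s : R) :
  differentiable f (s *: v + x) ->
  is_derive s 1 (fun r : R => f (r *: v + x)) ('D_v f (s *: v + x)).
Proof.
move=> df.
have E : (fun h : R => h^-1 *: ((fun r : R => f (r *: v + x)) (h *: (1 : R) + s)
            - f (s *: v + x)))
       = (fun h : R => h^-1 *: (f (h *: v + (s *: v + x)) - f (s *: v + x))).
  apply/funext => h /=; congr (_ *: (f _ - _)).
  by rewrite scalerDl addrA /GRing.scale /= mulr1.
have c : derivable f (s *: v + x) v by exact: diff_derivable.
by split; [rewrite /derivable /shift /= E|rewrite /derive /shift /= E].
Qed.

End Locality.

Section Schwarz.
Context {R : realType} {V : normedModType R}.
Implicit Types (f : V -> R) (O : set V).

Definition second_difference f (x v w : V) : R :=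
  f (v + w + x) - f (v + x) - (f (w + x) - f x).

(** By the mean value theorem in the direction [v], the second difference is
    [h] times an increment of ['D_v f] near [x]; the differential of ['D_v f] at
    [x] gives this increment up to [o(h)]. *)
Lemma second_difference_bound f O (x v w : V) : open O -> O x ->
  (forall y, O y -> differentiable f y) ->
  differentiable ('D_v f) x ->
  forall e, 0 < e -> \forall h \near (0 : R)^'+,
   `|second_difference f x (h *: v) (h *: w) - h ^+ 2 * 'D_w ('D_v f) x|
     <= e * h ^+ 2.
Proof.
move=> oO Ox df dDf e e0.
pose M := 2 * `|v| + 2 * `|w| + 1.
have M0 : 0 < M by rewrite ltr_wpDl// addr_ge0// mulr_ge0.
have eM0 : 0 < e / M by rewrite divr_gt0.
have B := differentiable_bound dDf eM0.
have C : \forall k \near (0 : V), O (k + x).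
  move: (open_nbhs_nbhs (conj oO Ox)).
  rewrite -[nbhs x O]/(\forall y \near x, O y) (near_shift 0) /=.
  by apply: filterS => z; rewrite /= subr0.
have D : nbhs (0 : V) [set k |
    `|'D_v f (k + x) - 'D_v f x - 'd ('D_v f) x k| <= e / M * `|k|
    /\ O (k + x)].
  exact: filterI B C.
have /nbhs_normP[d /= d0 Bd] := D.
near=> h.
have h0 : 0 < h by near: h; exact: nbhs_right_gt.
have hd : h * (`|v| + `|w|) < d.
  have vw0 : 0 < `|v| + `|w| + 1 by rewrite ltr_wpDl// addr_ge0.
  have hd : h < d / (`|v| + `|w| + 1).
    by near: h; apply: nbhs_right_lt; rewrite divr_gt0.
  rewrite ltr_pdivlMr// in hd; apply: le_lt_trans hd.
  by rewrite ler_wpM2l ?ltW// ltrDl.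
have inball a b : 0 <= a -> a <= h -> 0 <= b -> b <= h ->
    ball_ Num.norm (0 : V) d (a *: v + b *: w).
  move=> a0 ah b0 bh; rewrite /ball_ /= sub0r normrN.
  apply: le_lt_trans hd; apply: le_trans (ler_normD _ _) _.
  by rewrite !normrZ !ger0_norm// mulrDr lerD// ler_wpM2r.
pose phi (s : R) := f (s *: v + (h *: w + x)) - f (s *: v + x).
pose dphi (s : R) := 'D_v f (s *: v + (h *: w + x)) - 'D_v f (s *: v + x).
have dphiP s : 0 <= s -> s <= h -> is_derive s 1 phi (dphi s).
  move=> s0 sh; apply: is_deriveB; apply: differentiable_line; apply: df.
    by rewrite addrA; have [] := Bd _ (inball s h s0 sh (ltW h0) (lexx _)).
  have [_] := Bd _ (inball s 0 s0 sh (lexx _) (ltW h0)).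
  by rewrite scale0r addr0.
have [||c] := @MVT R phi dphi 0 h h0.
- by move=> s; rewrite in_itv /= => /andP[s0 sh]; apply: dphiP; exact: ltW.
- apply: derivable_within_continuous => s; rewrite in_itv /= => /andP[s0 sh].
  by have [] := dphiP s s0 sh.
rewrite in_itv /= => /andP[c0 ch] E.
have -> : second_difference f x (h *: v) (h *: w) = phi h - phi 0.
  by rewrite /second_difference /phi scale0r !add0r addrA.
rewrite E subr0.
have [b1 _] := Bd _ (inball c h (ltW c0) (ltW ch) (ltW h0) (lexx _)).
have [b2 _] := Bd _ (inball c 0 (ltW c0) (ltW ch) (lexx _) (ltW h0)).
rewrite scale0r addr0 in b2.
rewrite deriveE//.
have L : 'd ('D_v f) x (c *: v + h *: w) - 'd ('D_v f) x (c *: v)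
   = h * 'd ('D_v f) x w.
  by rewrite linearD addrAC subrr add0r linearZ.
have -> : dphi c * h - h ^+ 2 * 'd ('D_v f) x w
  = h * (('D_v f (c *: v + h *: w + x) - 'D_v f x
            - 'd ('D_v f) x (c *: v + h *: w))
         - ('D_v f (c *: v + x) - 'D_v f x - 'd ('D_v f) x (c *: v))).
  rewrite /dphi addrA.
  transitivity (h * ('D_v f (c *: v + h *: w + x) - 'D_v f (c *: v + x)
     - (h * 'd ('D_v f) x w))); first by ring.
  by rewrite -L; ring.
rewrite normrM (gtr0_norm h0) expr2 mulrA [leRHS]mulrC ler_pM2l//.
apply: le_trans (ler_normB _ _) _.
apply: le_trans (lerD b1 b2) _.
rewrite -mulrDr -ler_pdivlMl//.
rewrite [X in _ <= X](_ : _ = M * h); last by rewrite invf_div mulrA divfK ?gt_eqF//.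
have n1 : `|c *: v + h *: w| <= h * `|v| + h * `|w|.
  apply: le_trans (ler_normD _ _) _.
  by rewrite !normrZ (gtr0_norm c0) (gtr0_norm h0) lerD// ler_wpM2r// ltW.
have n2 : `|c *: v| <= h * `|v|.
  by rewrite normrZ (gtr0_norm c0) ler_wpM2r// ltW.
have n3 : 0 <= h * `|w| by rewrite mulr_ge0// ltW.
rewrite /M; nra.
Unshelve. all: by end_near. Qed.

(** Schwarz's theorem. The second difference is symmetric in [v] and [w], so
    both mixed derivatives are the limit of the same quotient. *)
Lemma derive_comm f O (x v w : V) : open O -> O x ->
  (forall y, O y -> differentiable f y) ->
  differentiable ('D_v f) x -> differentiable ('D_w f) x ->
  'D_w ('D_v f) x = 'D_v ('D_w f) x.
Proof.
move=> oO Ox df dv dw; apply/eqP; rewrite -subr_eq0 -normr_le0.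
apply/ler_addgt0Pl => e e0; rewrite addr0.
have e20 : 0 < e / 2 by rewrite divr_gt0.
have F1 := second_difference_bound w oO Ox df dv e20.
have F2 := second_difference_bound v oO Ox df dw e20.
have [h [[h0 b1] b2]] := filter_ex
  (filterI (filterI (nbhs_right_gt (0 : R)) F1) F2).
have s : second_difference f x (h *: w) (h *: v)
   = second_difference f x (h *: v) (h *: w).
  rewrite /second_difference (addrC (h *: w)).
  by move: (f (_ + _ + _)) (f (h *: v + x)) (f (h *: w + x)) => a b c; ring.
move: b1 b2; rewrite s.
move: (second_difference _ _ _ _) ('D_w ('D_v f) x) ('D_v ('D_w f) x) => a P Q.
move=> b1 b2; have hh : 0 < h ^+ 2 by rewrite exprn_gt0.
rewrite -(ler_pM2l hh) -[X in X * `|_|](gtr0_norm hh) -normrM.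
have -> : h ^+ 2 * (P - Q) = (a - h ^+ 2 * Q) - (a - h ^+ 2 * P) by ring.
apply: le_trans (ler_normB _ _) _; apply: le_trans (lerD b2 b1) _.
by rewrite -mulrDl -splitr mulrC.
Qed.

End Schwarz.

Section SecondDerivativeTest.
Context {R : realType} {V : normedModType R}.

Lemma line_near (O : set V) (x v : V) : open O -> O x ->
  \forall s \near (0 : R), O (s *: v + x).
Proof.
move=> oO Ox.
have c : {for (0 : R), continuous (fun s : R => s *: v + x)}.
  apply: cvgD; last exact: cvg_cst.
  exact: scalel_continuous.
apply: c; rewrite scale0r add0r; exact: open_nbhs_nbhs.
Qed.

(** If the second derivative were positive, the first derivative would be
    positive right after the origin of the line, by the expansion of ['D_v f]
    at [x], and [f] would take values larger than [f x]. *)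
Lemma second_derivative_test (f : V -> R) (O : set V) (x v : V) :
  open O -> O x -> (forall y, O y -> differentiable f y) ->
  differentiable ('D_v f) x ->
  (\forall s \near (0 : R), f (s *: v + x) <= f x) ->
  'D_v f x = 0 /\ 'D_v ('D_v f) x <= 0.
Proof.
move=> oO Ox df dDf fmax.
have D : nbhs (0 : R) [set s | O (s *: v + x) /\ f (s *: v + x) <= f x].
  exact: filterI (line_near v oO Ox) fmax.
have /nbhs_normP[d /= d0 Bd] := D.
pose phi (s : R) := f (s *: v + x).
have indom (s : R) : - d < s -> s < d -> O (s *: v + x) /\ phi s <= phi 0.
  move=> s0 s1; have := Bd s; rewrite /phi scale0r add0r; apply.
  by rewrite /ball_ /= sub0r normrN ltr_norml s0.
have dphi (s : R) : - d < s -> s < d ->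
    is_derive s 1 phi ('D_v f (s *: v + x)).
  by move=> s0 s1; apply: differentiable_line; apply: df; case: (indom s).
have d0' : - d < 0 by rewrite oppr_lt0.
have D0 : 'D_v f x = 0.
  have dd : - d <= d by rewrite ltW// (lt_trans d0').
  have H : is_derive (0 : R) 1 phi 0.
    apply: (@derive1_at_max _ phi (- d) d) => //.
    - by move=> t; rewrite in_itv /= => /andP[t0 t1]; have [] := dphi t t0 t1.
    - by rewrite in_itv /= d0' d0.
    - by move=> t; rewrite in_itv /= => /andP[t0 t1]; have [] := indom t t0 t1.
  have H' := dphi 0 d0' d0.
  rewrite -(@derive_val _ _ _ _ _ _ _ H) (@derive_val _ _ _ _ _ _ _ H').
  by rewrite scale0r add0r.
split=> //; rewrite leNgt; apply/negP => A0.
set A := 'D_v ('D_v f) x in A0.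
have e0 : 0 < A / (2 * (`|v| + 1)).
  by rewrite divr_gt0// mulr_gt0// ltr_wpDl.
have /nbhs_normP[r /= r0 Br] := differentiable_bound dDf e0.
have v1 : 0 < `|v| + 1 by rewrite ltr_wpDl.
pose h := Num.min d (r / (`|v| + 1)) / 2.
have m0 : 0 < Num.min d (r / (`|v| + 1)) by rewrite lt_min d0 divr_gt0.
have h0 : 0 < h by rewrite divr_gt0.
have hm : h < Num.min d (r / (`|v| + 1)) by rewrite ltr_pdivrMr// ltr_pMr ?ltr1n.
move: (hm); rewrite lt_min => /andP[hd hr].
have [||c] := @MVT R phi (fun s => 'D_v f (s *: v + x)) 0 h h0.
- move=> s; rewrite in_itv /= => /andP[s0 sh]; apply: dphi.
    exact: lt_trans s0.
  exact: lt_trans hd.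
- apply: derivable_within_continuous => s; rewrite in_itv /= => /andP[s0 sh].
  have [] // := dphi s; first exact: lt_le_trans s0.
  exact: le_lt_trans hd.
rewrite in_itv /= => /andP[c0 ch] E.
have [_ Hh] : O (h *: v + x) /\ phi h <= phi 0.
  by apply: indom => //; exact: lt_trans h0.
have g0 : 0 < 'D_v f (c *: v + x).
  have := Br (c *: v); rewrite /ball_ /= sub0r normrN => /(_ _).
  have cr : `|c *: v| < r.
    rewrite normrZ (gtr0_norm c0).
    rewrite ltr_pdivlMr// in hr; apply: le_lt_trans hr.
    by apply: ler_pM => //; [exact: ltW|exact: ltW|rewrite lerDl].
  move=> /(_ cr); rewrite D0 subr0 linearZ /=.
  rewrite -(deriveE _ dDf) -/A normrZ (gtr0_norm c0).
  move: ('D_v f (c *: v + x)) => g; rewrite ler_norml => /andP[+ _].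
  rewrite /GRing.scale /= => H.
  have H2 : A / (2 * (`|v| + 1)) * (c * `|v|) <= c * A / 2.
    rewrite invfM mulrA [leRHS]mulrC.
    rewrite [leLHS](_ : _ = 2^-1 * (c * A * (`|v| / (`|v| + 1)))); last by ring.
    rewrite ler_pM2l// ger_pMr ?mulr_gt0// ler_pdivrMr// mul1r.
    by rewrite lerDl.
  have cA : 0 < c * A by rewrite mulr_gt0.
  lra.
have : 0 < phi h - phi 0 by rewrite E subr0 mulr_gt0.
by rewrite subr_gt0 ltNge Hh.
Qed.

End SecondDerivativeTest.

(** * Smooth functions on an open set *)

Section SmoothFunctions.
Context {R : realType} {V W : normedModType R}.
Variables (O : set V).
Hypothesis oO : open O.
Implicit Types f g : V -> W.

(** Closure properties go by induction on the number of derivatives, because a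
    derivative of a product or of an inverse is again a sum of products. *)
Fixpoint smooth_upto (n : nat) f : Prop :=
  (forall x, O x -> differentiable f x) /\
  (if n is m.+1 then forall v, smooth_upto m (fun x => 'D_v f x) else True).

Lemma smooth_openP f : smooth_open O f <-> forall n, smooth_upto n f.
Proof.
split=> [sf n|sf vs].
  elim: n f sf => [|n IH] f sf; first by split=> // x; exact: (sf [::]).
  split=> [x|v]; first exact: (sf [::]).
  apply: IH => vs x Ox; have := sf (rcons vs v) x Ox.
  by rewrite /iter_derive foldr_rcons.
elim/last_ind: vs f sf => [|vs v IH] f sf x Ox.
  by have [df _] := sf 0%N; exact: df.
rewrite /iter_derive foldr_rcons; apply: IH => // n.
by have [_] := sf n.+1; apply.
Qed.

Lemma smooth_open_derive f v :
  smooth_open O f -> smooth_open O (fun x => 'D_v f x).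
Proof.
move=> /smooth_openP sf; apply/smooth_openP => n.
by have [_] := sf n.+1; apply.
Qed.

Lemma smooth_open_differentiable f x :
  smooth_open O f -> O x -> differentiable f x.
Proof. by move=> sf; exact: (sf [::]). Qed.

Lemma open_near_eq f g x : O x -> (forall y, O y -> f y = g y) ->
  {near x, f =1 g}.
Proof. by move=> Ox fg; apply: filterS (open_nbhs_nbhs (conj oO Ox)). Qed.

Lemma eq_smooth_upto n f g : (forall y, O y -> f y = g y) ->
  smooth_upto n f -> smooth_upto n g.
Proof.
elim: n f g => [|n IH] f g fg [df sf]; split=> //.
- by move=> x Ox; exact: near_eq_differentiable (open_near_eq Ox fg) (df x Ox).
- by move=> x Ox; exact: near_eq_differentiable (open_near_eq Ox fg) (df x Ox).
- move=> v; apply: IH (sf v) => y Oy.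
  by apply: near_eq_derive; exact: open_near_eq.
Qed.

Lemma eq_smooth_open f g : (forall y, O y -> f y = g y) ->
  smooth_open O f -> smooth_open O g.
Proof.
move=> fg /smooth_openP sf; apply/smooth_openP => n.
exact: eq_smooth_upto fg (sf n).
Qed.

Lemma smooth_uptoW n f : smooth_upto n.+1 f -> smooth_upto n f.
Proof.
elim: n f => [|n IH] f [df sf]; split=> // v.
by apply: IH; exact: sf.
Qed.

Lemma smooth_upto_cst n c : smooth_upto n (cst c : V -> W).
Proof.
elim: n c => [|n IH] c; 
  (split; first by move=> x _; exact: differentiable_cst) => // v.
apply: eq_smooth_upto (IH 0) => y _ /=.
by rewrite derive_cst.
Qed.

Lemma smooth_uptoD n f g : smooth_upto n f -> smooth_upto n g ->
  smooth_upto n (f + g).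
Proof.
elim: n f g => [|n IH] f g [df sf] [dg sg]; 
  (split; first by move=> x Ox; apply: differentiableD; [exact: df|exact: dg])
  => // v.
apply: eq_smooth_upto (IH _ _ (sf v) (sg v)) => y Oy /=.
by rewrite deriveD//; apply: diff_derivable; [exact: df|exact: dg].
Qed.

Lemma smooth_uptoN n f : smooth_upto n f -> smooth_upto n (- f).
Proof.
elim: n f => [|n IH] f [df sf]; 
  (split; first by move=> x Ox; apply: differentiableN; exact: df) => // v.
apply: eq_smooth_upto (IH _ (sf v)) => y Oy /=.
by rewrite deriveN//; apply: diff_derivable; exact: df.
Qed.

End SmoothFunctions.

Section SmoothScalars.
Context {R : realType} {V : normedModType R}.
Variables (O : set V).
Hypothesis oO : open O.
Implicit Types f g : V -> R.

Lemma smooth_uptoM n f g : smooth_upto O n f -> smooth_upto O n g ->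
  smooth_upto O n (f * g).
Proof.
elim: n f g => [|n IH] f g sf sg.
  case: sf sg => [df _] [dg _]; split=> // x Ox.
  by apply: differentiableM; [exact: df|exact: dg].
have sf' := smooth_uptoW sf; have sg' := smooth_uptoW sg.
case: sf sg => [df sf] [dg sg]; split=> // [x Ox|v].
  by apply: differentiableM; [exact: df|exact: dg].
apply: (eq_smooth_upto oO) (smooth_uptoD oO (IH _ _ sf' (sg v))
  (IH _ _ sg' (sf v))) => y Oy /=.
by rewrite deriveM//; apply: diff_derivable; [exact: df|exact: dg].
Qed.

Lemma smooth_uptoV n f : (forall x, O x -> f x != 0) ->
  smooth_upto O n f -> smooth_upto O n (fun x => (f x)^-1).
Proof.
move=> f0; elim: n => [|n IH] sf.
  by case: sf => [df _]; split=> // x Ox; apply: differentiableV; auto.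
have sf' := smooth_uptoW sf; case: sf => [df sf]; split=> // [x Ox|v].
  by apply: differentiableV; auto.
have sV := IH sf'.
apply: (eq_smooth_upto oO) (smooth_uptoN oO (smooth_uptoM
  (smooth_uptoM sV sV) (sf v))) => y Oy.
rewrite deriveV//; [|exact: f0|by apply: diff_derivable; exact: df].
by rewrite !fctE /GRing.scale /= mulNr -invfM -expr2.
Qed.

Lemma smooth_open_cst c : smooth_open O (cst c : V -> R).
Proof. by apply/smooth_openP => n; exact: smooth_upto_cst. Qed.

Lemma smooth_openD f g :
  smooth_open O f -> smooth_open O g -> smooth_open O (f + g).
Proof.
move=> /smooth_openP sf /smooth_openP sg; apply/smooth_openP => n.
exact: smooth_uptoD.
Qed.

Lemma smooth_openN f : smooth_open O f -> smooth_open O (- f).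
Proof.
by move=> /smooth_openP sf; apply/smooth_openP => n; exact: smooth_uptoN.
Qed.

Lemma smooth_openM f g :
  smooth_open O f -> smooth_open O g -> smooth_open O (f * g).
Proof.
move=> /smooth_openP sf /smooth_openP sg; apply/smooth_openP => n.
exact: smooth_uptoM.
Qed.

Lemma smooth_openV f : (forall x, O x -> f x != 0) ->
  smooth_open O f -> smooth_open O (fun x => (f x)^-1).
Proof.
move=> f0 /smooth_openP sf; apply/smooth_openP => n.
exact: smooth_uptoV.
Qed.

End SmoothScalars.

Lemma smooth_open_coord (R : realType) (V : normedModType R) (O : set V)
    m (F : V -> 'rV[R]_m.+1) (k : 'I_m.+1) : open O ->
  smooth_open O F -> smooth_open O (fun x => F x 0 k).
Proof.
move=> oO /smooth_openP sF; apply/smooth_openP => n.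
elim: n F sF => [|n IH] F sF; case: (sF 1%N) => [dF _]; 
  (split; first by move=> x Ox;
     exact: (differentiable_comp (dF x Ox) (differentiable_coord (F x) 0 k)))
  => // v.
have sDF : forall m, smooth_upto O m (fun x => 'D_v F x).
  by move=> p; have [_] := sF p.+1; apply.
apply: (eq_smooth_upto oO) (IH _ sDF) => y Oy /=.
rewrite derive_mx ?mxE//; exact/diff_derivable/dF.
Qed.

(** * The differential ring of smooth functions *)

(** The point makes the ring of smooth functions on the set nontrivial. *)
Record pointed_open (V : topologicalType) := PointedOpen {
  po_set : set V ;
  po_pt : V ;
  po_open : open po_set ;
  po_mem : po_set po_pt }.

(** The keys seal the operations below, which otherwise unfold to terms
    containing smoothness proofs whenever two of them are compared. *)
Fact cinf0_key : unit. Proof. exact: tt. Qed.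
Fact cinf1_key : unit. Proof. exact: tt. Qed.
Fact cinfN_key : unit. Proof. exact: tt. Qed.
Fact cinfD_key : unit. Proof. exact: tt. Qed.
Fact cinfM_key : unit. Proof. exact: tt. Qed.
Fact cinf_der_key : unit. Proof. exact: tt. Qed.

Section Cinf.
Context {R : realType} {V : normedModType R}.
Variable U : pointed_open V.
Local Notation O := (po_set U).

(** Smooth functions on the open set are extended by zero, so that equal
    elements of the ring are the functions which agree on the set. *)
Record cinf := Cinf {
  cinf_fun :> V -> R ;
  cinf_prop :
    `[< smooth_open O cinf_fun /\ forall x, ~ O x -> cinf_fun x = 0 >] }.

HB.instance Definition _ := [isSub for cinf_fun].
HB.instance Definition _ := [Choice of cinf by <:].

Lemma cinf_smooth (a : cinf) : smooth_open O a.
Proof. by have /asboolP[] := cinf_prop a. Qed.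

Lemma cinf_ext (a b : cinf) : (forall x, O x -> a x = b x) -> a = b.
Proof.
move=> ab; apply/val_inj/funext => x /=; have [/ab//|nUx] := pselect (O x).
have /asboolP[_ ->//] := cinf_prop a.
by have /asboolP[_ ->] := cinf_prop b.
Qed.

Lemma mk_cinf_subproof (f : V -> R) : smooth_open O f ->
  `[< smooth_open O (fun x => if `[< O x >] then f x else 0) /\
      forall x, ~ O x -> (if `[< O x >] then f x else 0) = 0 >].
Proof.
move=> sf; apply/asboolP; split; last by move=> x nUx; rewrite asboolF.
by apply: (eq_smooth_open (@po_open _ U)) sf => y Uy; rewrite asboolT.
Qed.

Definition mk_cinf (f : V -> R) (sf : smooth_open O f) : cinf :=
  Cinf (mk_cinf_subproof sf).

Lemma mk_cinfE f (sf : smooth_open O f) x : O x -> mk_cinf sf x = f x.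
Proof. by move=> Ux; rewrite /= asboolT. Qed.

Let oU := @po_open _ U.
Definition cinf0 : cinf := locked_with cinf0_key (mk_cinf (smooth_open_cst oU 0)).
Definition cinf1 : cinf := locked_with cinf1_key (mk_cinf (smooth_open_cst oU 1)).
Definition cinfN (a : cinf) : cinf :=
  locked_with cinfN_key (mk_cinf (smooth_openN oU (cinf_smooth a))).
Definition cinfD (a b : cinf) : cinf :=
  locked_with cinfD_key (mk_cinf (smooth_openD oU (cinf_smooth a) (cinf_smooth b))).
Definition cinfM (a b : cinf) : cinf :=
  locked_with cinfM_key (mk_cinf (smooth_openM oU (cinf_smooth a) (cinf_smooth b))).

Lemma cinf0E x : O x -> cinf0 x = 0.
Proof. by move=> Ox; rewrite /cinf0 unlock mk_cinfE. Qed.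
Lemma cinf1E x : O x -> cinf1 x = 1.
Proof. by move=> Ox; rewrite /cinf1 unlock mk_cinfE. Qed.
Lemma cinfNE a x : O x -> cinfN a x = - a x.
Proof. by move=> Ox; rewrite /cinfN unlock mk_cinfE. Qed.
Lemma cinfDE a b x : O x -> cinfD a b x = a x + b x.
Proof. by move=> Ox; rewrite /cinfD unlock mk_cinfE. Qed.
Lemma cinfME a b x : O x -> cinfM a b x = a x * b x.
Proof. by move=> Ox; rewrite /cinfM unlock mk_cinfE. Qed.

Lemma cinfDA : associative cinfD.
Proof. by move=> a b c; apply: cinf_ext => x Ox; rewrite !cinfDE// addrA. Qed.
Lemma cinfDC : commutative cinfD.
Proof. by move=> a b; apply: cinf_ext => x Ox; rewrite !cinfDE// addrC. Qed.
Lemma cinf0D : left_id cinf0 cinfD.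
Proof. by move=> a; apply: cinf_ext => x Ox; rewrite cinfDE// cinf0E// add0r. Qed.
Lemma cinfND : left_inverse cinf0 cinfN cinfD.
Proof.
by move=> a; apply: cinf_ext => x Ox; rewrite cinfDE// cinfNE// cinf0E// addNr.
Qed.

HB.instance Definition _ := GRing.isZmodule.Build cinf cinfDA cinfDC cinf0D cinfND.

Lemma cinfMA : associative cinfM.
Proof. by move=> a b c; apply: cinf_ext => x Ox; rewrite !cinfME// mulrA. Qed.
Lemma cinfMC : commutative cinfM.
Proof. by move=> a b; apply: cinf_ext => x Ox; rewrite !cinfME// mulrC. Qed.
Lemma cinf1M : left_id cinf1 cinfM.
Proof. by move=> a; apply: cinf_ext => x Ox; rewrite cinfME// cinf1E// mul1r. Qed.
Lemma cinfMDl : left_distributive cinfM cinfD.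
Proof.
move=> a b c; apply: cinf_ext => x Ox.
by rewrite cinfME// !cinfDE// !cinfME// mulrDl.
Qed.
Lemma cinf1_neq0 : cinf1 != cinf0.
Proof.
apply/eqP => /(congr1 (fun a : cinf => a (po_pt U))).
rewrite cinf1E ?cinf0E; try exact: po_mem.
by move/eqP; rewrite oner_eq0.
Qed.

HB.instance Definition _ := GRing.Zmodule_isComNzRing.Build cinf
  cinfMA cinfMC cinf1M cinfMDl cinf1_neq0.

Definition cinf_eval (x : V) (Ux : O x) (a : cinf) : R := a x.

Lemma cinf_evalE x (Ux : O x) a : cinf_eval Ux a = a x.
Proof. by []. Qed.

Section Eval.
Variables (x : V) (Ux : O x).

Lemma cinf_evalB : zmod_morphism (cinf_eval Ux).
Proof. by move=> a b; rewrite /cinf_eval cinfDE// cinfNE. Qed.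

Lemma cinf_evalM : monoid_morphism (cinf_eval Ux).
Proof.
by split=> [|a b]; rewrite /cinf_eval; [exact: cinf1E|exact: cinfME].
Qed.

HB.instance Definition _ :=
  GRing.isZmodMorphism.Build cinf R (cinf_eval Ux) cinf_evalB.
HB.instance Definition _ :=
  GRing.isMonoidMorphism.Build cinf R (cinf_eval Ux) cinf_evalM.

Lemma cinf_evD a b : cinf_eval Ux (a + b) = cinf_eval Ux a + cinf_eval Ux b.
Proof. exact: (rmorphD (cinf_eval Ux)). Qed.
Lemma cinf_evN a : cinf_eval Ux (- a) = - cinf_eval Ux a.
Proof. exact: (rmorphN (cinf_eval Ux)). Qed.
Lemma cinf_evM a b : cinf_eval Ux (a * b) = cinf_eval Ux a * cinf_eval Ux b.
Proof. exact: (rmorphM (cinf_eval Ux)). Qed.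
Lemma cinf_evX a n : cinf_eval Ux (a ^+ n) = cinf_eval Ux a ^+ n.
Proof. exact: (rmorphXn (cinf_eval Ux)). Qed.
Lemma cinf_ev_nat n : cinf_eval Ux n%:R = n%:R.
Proof. exact: (rmorph_nat (cinf_eval Ux)). Qed.
Lemma cinf_ev1 : cinf_eval Ux 1 = 1.
Proof. exact: (rmorph1 (cinf_eval Ux)). Qed.
Lemma cinf_ev0 : cinf_eval Ux 0 = 0.
Proof. exact: (rmorph0 (cinf_eval Ux)). Qed.

Definition cinf_evE := (cinf_evD, cinf_evN, cinf_evM, cinf_evX, cinf_ev_nat,
  cinf_ev1, cinf_ev0).

End Eval.

Lemma cinf_eqP (a b : cinf) :
  (forall x (Ux : O x), cinf_eval Ux a = cinf_eval Ux b) -> a = b.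
Proof. by move=> ab; apply: cinf_ext => x Ux; exact: ab Ux. Qed.

Definition cinf_der (v : V) (a : cinf) : cinf :=
  locked_with cinf_der_key (mk_cinf (smooth_open_derive v (cinf_smooth a))).

Lemma cinf_derE v a x : O x -> cinf_der v a x = 'D_v a x.
Proof. by move=> Ox; rewrite /cinf_der unlock mk_cinfE. Qed.

Lemma cinf_der_eq (f : V -> R) v (a : cinf) x : O x -> (forall y, O y -> a y = f y) ->
  cinf_der v a x = 'D_v f x.
Proof.
move=> Ox af; rewrite cinf_derE//; apply: near_eq_derive.
exact: (open_near_eq (@po_open _ U)).
Qed.

Lemma cinf_differentiable (a : cinf) x : O x -> differentiable a x.
Proof. exact/smooth_open_differentiable/cinf_smooth. Qed.

Lemma cinf_der_derivation v : derivation (cinf_der v).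
Proof.
split=> a b; apply: cinf_ext => x Ox.
  rewrite (@cinf_der_eq (fun y => a y + b y))//; last by move=> y Oy; exact: cinfDE.
  rewrite deriveD; try exact/diff_derivable/cinf_differentiable.
  by rewrite cinfDE// !cinf_derE.
rewrite (@cinf_der_eq (fun y => a y * b y))//; last by move=> y Oy; exact: cinfME.
rewrite deriveM; try exact/diff_derivable/cinf_differentiable.
rewrite cinfDE// !cinfME// !cinf_derE//.
by rewrite addrC; congr (_ + _); rewrite /GRing.scale /= mulrC.
Qed.

Lemma cinf_der_comm v w a : cinf_der w (cinf_der v a) = cinf_der v (cinf_der w a).
Proof.
apply: cinf_ext => x Ux.
rewrite (cinf_der_eq _ Ux (fun y Oy => cinf_derE v a Oy)).
rewrite (cinf_der_eq _ Ux (fun y Oy => cinf_derE w a Oy)).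
apply: (derive_comm (@po_open _ U)) => //.
- by move=> y; exact: cinf_differentiable.
- exact: (smooth_open_differentiable (smooth_open_derive v (cinf_smooth a))).
- exact: (smooth_open_differentiable (smooth_open_derive w (cinf_smooth a))).
Qed.

Lemma cinf_second_derivative_test (a : cinf) (x v : V) (Ux : O x) :
  (\forall s \near (0 : R), a (s *: v + x) <= a x) ->
  cinf_eval Ux (cinf_der v a) = 0 /\
  cinf_eval Ux (cinf_der v (cinf_der v a)) <= 0.
Proof.
move=> amax; rewrite /cinf_eval.
rewrite (cinf_der_eq _ Ux (fun y Oy => cinf_derE v a Oy)) cinf_derE//.
apply: (second_derivative_test (@po_open _ U)) => //.
  by move=> y; exact: cinf_differentiable.
exact: (smooth_open_differentiable (smooth_open_derive v (cinf_smooth a))).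
Qed.

End Cinf.

(** * Principal curvatures of a parametrized surface *)

Definition o0 : 'I_3 := @Ordinal 3 0 isT.
Definition o1 : 'I_3 := @Ordinal 3 1 isT.
Definition o2 : 'I_3 := @Ordinal 3 2 isT.

Lemma dot3 (R : realType) (v w : 'rV[R]_3) :
  dot v w = v 0 o0 * w 0 o0 + v 0 o1 * w 0 o1 + v 0 o2 * w 0 o2.
Proof.
rewrite /dot !big_ord_recl big_ord0 addr0 addrA.
by congr (v _ _ * w _ _ + v _ _ * w _ _ + v _ _ * w _ _); apply: val_inj.
Qed.

Section Pointwise.
Variable R : realFieldType.
Variables (a0 a1 a2 b0 b1 b2 n0 n1 n2 : R).
Let c0 := a1 * b2 - a2 * b1.
Let c1 := a2 * b0 - a0 * b2.
Let c2 := a0 * b1 - a1 * b0.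
Let G := (a0 * a0 + a1 * a1 + a2 * a2) * (b0 * b0 + b1 * b1 + b2 * b2)
  - (a0 * b0 + a1 * b1 + a2 * b2) ^+ 2.

(** The normal [n] is parallel to the cross product [c], and [G] is the square
    of the length of [c]. Hence [n] is [c] over its length up to sign, and the
    sign disappears in a product of two components of [n]. *)
Lemma unit_normal_products :
  G != 0 -> n0 * n0 + n1 * n1 + n2 * n2 = 1 ->
  a0 * n0 + a1 * n1 + a2 * n2 = 0 -> b0 * n0 + b1 * n1 + b2 * n2 = 0 ->
  forall u0 u1 u2 v0 v1 v2,
  (u0 * n0 + u1 * n1 + u2 * n2) * (v0 * n0 + v1 * n1 + v2 * n2) * G
  = (u0 * c0 + u1 * c1 + u2 * c2) * (v0 * c0 + v1 * c1 + v2 * c2).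
Proof.
move=> Gn0 nn na nb u0 u1 u2 v0 v1 v2.
set s := n0 * c0 + n1 * c1 + n2 * c2.
(* expansion of [n] in the basis dual to [a], [b], [c], as [n] is orthogonal to
   [a] and [b] *)
have e0 : n0 * G = s * c0.
  transitivity (s * c0 + (a0 * n0 + a1 * n1 + a2 * n2) * (b1 * c2 - b2 * c1)
    + (b0 * n0 + b1 * n1 + b2 * n2) * (c1 * a2 - c2 * a1)).
    by rewrite /s /G /c0 /c1 /c2; ring.
  by rewrite na nb; ring.
have e1 : n1 * G = s * c1.
  transitivity (s * c1 + (a0 * n0 + a1 * n1 + a2 * n2) * (b2 * c0 - b0 * c2)
    + (b0 * n0 + b1 * n1 + b2 * n2) * (c2 * a0 - c0 * a2)).
    by rewrite /s /G /c0 /c1 /c2; ring.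
  by rewrite na nb; ring.
have e2 : n2 * G = s * c2.
  transitivity (s * c2 + (a0 * n0 + a1 * n1 + a2 * n2) * (b0 * c1 - b1 * c0)
    + (b0 * n0 + b1 * n1 + b2 * n2) * (c0 * a1 - c1 * a0)).
    by rewrite /s /G /c0 /c1 /c2; ring.
  by rewrite na nb; ring.
have eG : G = c0 * c0 + c1 * c1 + c2 * c2 by rewrite /G /c0 /c1 /c2; ring.
have es : G = s ^+ 2.
  apply: (mulIf Gn0).
  transitivity (n0 * G * (n0 * G) + n1 * G * (n1 * G) + n2 * G * (n2 * G)).
    by transitivity ((n0 * n0 + n1 * n1 + n2 * n2) * (G * G)); [rewrite nn mul1r|ring].
  by rewrite e0 e1 e2 [in RHS]eG; ring.
clearbody G s c0 c1 c2.
apply: (mulIf Gn0).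
transitivity ((u0 * (n0 * G) + u1 * (n1 * G) + u2 * (n2 * G))
  * (v0 * (n0 * G) + v1 * (n1 * G) + v2 * (n2 * G))); first by ring.
by rewrite e0 e1 e2 [in RHS]es; ring.
Qed.

(** [S ^+ 2] and [K] only involve products of two entries of the second
    fundamental form [h], and these are known from the form [c] computed with
    the cross product. *)
Lemma normalized_curvatures (S K D i h00 h01 h11 g00 g01 g11 c00 c01 c11 : R) :
  i * D = 1 ->
  S * D = h00 * g11 - 2 * h01 * g01 + h11 * g00 ->
  K * D = h00 * h11 - h01 ^+ 2 ->
  h00 * h00 * D = c00 * c00 -> h00 * h01 * D = c00 * c01 ->
  h00 * h11 * D = c00 * c11 -> h01 * h01 * D = c01 * c01 ->
  h01 * h11 * D = c01 * c11 -> h11 * h11 * D = c11 * c11 ->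
  S ^+ 2 = (c00 * g11 - 2 * c01 * g01 + c11 * g00) ^+ 2 * i ^+ 3 /\
  K = (c00 * c11 - c01 ^+ 2) * i ^+ 2.
Proof.
move=> iD eS eK e1 e2 e3 e4 e5 e6; split.
  transitivity ((S * D) ^+ 2 * D * i ^+ 3).
    by transitivity (S ^+ 2 * (i * D) ^+ 3); [rewrite iD expr1n mulr1|ring].
  rewrite eS; congr (_ * _).
  transitivity (h00 * h00 * D * g11 ^+ 2 + 4 * (h01 * h01 * D) * g01 ^+ 2
    + h11 * h11 * D * g00 ^+ 2 - 4 * (h00 * h01 * D) * g11 * g01
    + 2 * (h00 * h11 * D) * g11 * g00 - 4 * (h01 * h11 * D) * g01 * g00).
    by ring.
  by rewrite e1 e2 e3 e4 e5 e6; ring.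
transitivity (K * D * D * i ^+ 2).
  by transitivity (K * (i * D) ^+ 2); [rewrite iD expr1n mulr1|ring].
rewrite eK; congr (_ * _).
transitivity (h00 * h11 * D - h01 * h01 * D); first by ring.
by rewrite e3 e4 expr2.
Qed.

(** [G] is the square of the length of the cross product [c] (Lagrange), and by
    Cauchy-Binet the determinant of the hypothesis vanishes with [c]. *)
Lemma gram_gt0 (x0 x1 x2 y0 y1 y2 : R) :
  (a0 * x0 + a1 * x1 + a2 * x2) * (b0 * y0 + b1 * y1 + b2 * y2)
  - (a0 * y0 + a1 * y1 + a2 * y2) * (b0 * x0 + b1 * x1 + b2 * x2) != 0 ->
  0 < G.
Proof.
move=> D0.
have eG : G = c0 ^+ 2 + c1 ^+ 2 + c2 ^+ 2 by rewrite /G /c0 /c1 /c2; ring.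
have G0 : 0 <= G by rewrite eG !addr_ge0// sqr_ge0.
rewrite lt_neqAle G0 andbT eq_sym; apply: contra_neq D0 => GZ.
have Z (z : R) : z ^+ 2 <= G -> z = 0.
  by rewrite GZ => z0; apply/eqP; rewrite -sqrf_eq0 eq_le z0 sqr_ge0.
have z0 : c0 = 0 by apply: Z; rewrite eG -addrA lerDl addr_ge0// sqr_ge0.
have z1 : c1 = 0.
  by apply: Z; rewrite eG [leRHS]addrAC lerDr addr_ge0// sqr_ge0.
have z2 : c2 = 0 by apply: Z; rewrite eG lerDr addr_ge0// sqr_ge0.
transitivity (c0 * (x1 * y2 - x2 * y1) + c1 * (x2 * y0 - x0 * y2)
  + c2 * (x0 * y1 - x1 * y0)); first by rewrite /c0 /c1 /c2; ring.
by rewrite z0 z1 z2 !mul0r !addr0.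
Qed.

End Pointwise.

Lemma row_free_gram_gt0 (R : realType) (r : 'I_2 -> 'rV[R]_3) :
  row_free (\matrix_(k < 2) r k) ->
  0 < dot (r 0) (r 0) * dot (r 1) (r 1) - dot (r 0) (r 1) * dot (r 1) (r 0).
Proof.
move=> /row_freeP[B MB].
have Me i j : (\matrix_(k < 2) r k *m B) i j
    = r i 0 o0 * B o0 j + r i 0 o1 * B o1 j + r i 0 o2 * B o2 j.
  rewrite !mxE !big_ord_recl big_ord0 addr0 !mxE addrA.
  by congr (r _ _ _ * B _ _ + r _ _ _ * B _ _ + r _ _ _ * B _ _); apply: val_inj.
have sym : dot (r 1) (r 0) = dot (r 0) (r 1) by apply: eq_bigr => i _; rewrite mulrC.
rewrite sym -expr2 !dot3; apply: (@gram_gt0 _ _ _ _ _ _ _ (B o0 0) (B o1 0)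
  (B o2 0) (B o0 1) (B o1 1) (B o2 1)).
by rewrite -!Me MB !mxE /= !mulr1n mulr0n mulr0 subr0 mulr1 oner_eq0.
Qed.

Section CurvatureData.
Context {R : realType}.
Notation V := ('rV[R]_2 * R)%type.

Definition space_dir (i : 'I_2) : V := (delta_mx 0 i, 0).
Definition time_dir : V := (0, 1).

Definition first_form_at (F : V -> 'rV[R]_3) (x : V) : 'M[R]_2 :=
  \matrix_(i, j) dot ('D_(space_dir i) F x) ('D_(space_dir j) F x).

Definition second_form_at (F : V -> 'rV[R]_3) (n : 'rV[R]_3) (x : V) : 'M[R]_2 :=
  \matrix_(i, j) - dot ('D_(space_dir i) (fun y => 'D_(space_dir j) F y) x) n.

Record curvature_data (F : V -> 'rV[R]_3) (x : V) (n : 'rV[R]_3) (a b : R)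
    : Prop := CurvatureData {
  cd_unit : dot n n = 1 ;
  cd_normal : forall k, dot ('D_(space_dir k) F x) n = 0 ;
  cd_free : row_free (\matrix_(k < 2) 'D_(space_dir k) F x) ;
  cd_roots : char_poly (second_form_at F n x *m invmx (first_form_at F x))
    = ('X - a%:P) * ('X - b%:P) }.

Variables (U : pointed_open V) (F : V -> 'rV[R]_3).
Hypothesis sF : smooth_open (po_set U) F.
Local Notation O := (po_set U).
Let oU := @po_open _ U.

Definition coord_fun (k : 'I_3) : cinf U := mk_cinf (smooth_open_coord k oU sF).
Local Notation f0 := (coord_fun o0).
Local Notation f1 := (coord_fun o1).
Local Notation f2 := (coord_fun o2).
Local Notation p0 := (@cinf_der R _ U (space_dir 0)).
Local Notation p1 := (@cinf_der R _ U (space_dir 1)).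

Lemma cinf_der_coord v k x : O x -> cinf_der v (coord_fun k) x = ('D_v F x) 0 k.
Proof.
move=> Ux; rewrite (cinf_der_eq (f := fun y => F y 0 k))//; last first.
  by move=> y Oy; rewrite mk_cinfE.
rewrite derive_mx ?mxE//.
exact/diff_derivable/(smooth_open_differentiable sF).
Qed.

Lemma cinf_der2_coord v w k x : O x ->
  cinf_der v (cinf_der w (coord_fun k)) x
  = ('D_v (fun y => 'D_w F y) x) 0 k.
Proof.
move=> Ux; have sDF := smooth_open_derive w sF.
rewrite (cinf_der_eq _ Ux (fun y Oy => cinf_der_coord w k Oy)).
rewrite derive_mx ?mxE//.
exact/diff_derivable/(smooth_open_differentiable sDF).
Qed.

Let g := metric f0 f1 f2.
Definition gram : cinf U := g p0 p0 * g p1 p1 - g p0 p1 ^+ 2.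

Let c0 := p0 f1 * p1 f2 - p0 f2 * p1 f1.
Let c1 := p0 f2 * p1 f0 - p0 f0 * p1 f2.
Let c2 := p0 f0 * p1 f1 - p0 f1 * p1 f0.
Let c := sff c0 c1 c2 f0 f1 f2.

Lemma first_form_atE (x : V) (Ux : O x) :
  [/\ first_form_at F x 0 0 = cinf_eval Ux (g p0 p0),
      first_form_at F x 0 1 = cinf_eval Ux (g p0 p1),
      first_form_at F x 1 0 = cinf_eval Ux (g p0 p1) &
      first_form_at F x 1 1 = cinf_eval Ux (g p1 p1)].
Proof.
have E i j : first_form_at F x i j = cinf_eval Ux
    (g (cinf_der (space_dir i)) (cinf_der (space_dir j))).
  rewrite mxE dot3 /g /metric !cinf_evE.
  by rewrite !cinf_evalE !(cinf_der_coord _ _ Ux).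
have gC : g p1 p0 = g p0 p1.
  by rewrite /g /metric; congr (_ + _ + _); exact: mulrC.
by split; rewrite E// gC.
Qed.

Lemma second_form_atE (n : 'rV[R]_3) (x : V) (Ux : O x) i j :
  second_form_at F n x i j =
  - (n 0 o0 * cinf_eval Ux (cinf_der (space_dir i) (cinf_der (space_dir j) f0))
   + n 0 o1 * cinf_eval Ux (cinf_der (space_dir i) (cinf_der (space_dir j) f1))
   + n 0 o2 * cinf_eval Ux (cinf_der (space_dir i) (cinf_der (space_dir j) f2))).
Proof.
rewrite mxE dot3 !cinf_evalE !(cinf_der2_coord _ _ _ Ux).
by congr (- (_ + _ + _)); rewrite mulrC.
Qed.

Lemma second_form_at_sym (n : 'rV[R]_3) (x : V) (Ux : O x) :
  second_form_at F n x 0 1 = second_form_at F n x 1 0.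
Proof.
rewrite !(second_form_atE _ Ux); congr (- (_ * _ + _ * _ + _ * _));
  by rewrite cinf_der_comm.
Qed.

Lemma curvature_data_roots (x : V) (Ux : O x) n a b :
  curvature_data F x n a b ->
  let h := second_form_at F n x in let e := cinf_eval Ux in
  [/\ 0 < e gram,
      (a + b) * e gram = h 0 0 * e (g p1 p1) - 2 * h 0 1 * e (g p0 p1)
         + h 1 1 * e (g p0 p0) &
      a * b * e gram = h 0 0 * h 1 1 - h 0 1 ^+ 2].
Proof.
case=> nn nd fr cp h e.
have [g00 g01 g10 g11] := first_form_atE Ux.
have gE : e gram = first_form_at F x 0 0 * first_form_at F x 1 1
    - first_form_at F x 0 1 * first_form_at F x 1 0.
  rewrite g00 g01 g10 g11 -expr2.
  by rewrite /gram /e cinf_evD cinf_evN cinf_evX cinf_evM.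
have ffE i j : first_form_at F x i j
    = dot ('D_(space_dir i) F x) ('D_(space_dir j) F x) by rewrite mxE.
have G0 : 0 < e gram by rewrite gE !ffE; exact: (row_free_gram_gt0 fr).
have gu : first_form_at F x \in unitmx.
  by rewrite unitmxE det_mx22 unitfE -gE gt_eqF.
have [r1 r2] := char_poly2_roots gu cp.
rewrite -gE -(second_form_at_sym n Ux) g00 g01 g10 g11 -/h in r1 r2.
have E (s t y z : R) : s - t * y - t * y + z = s - 2 * t * y + z by ring.
by split=> //; rewrite r1; exact: E.
Qed.

Lemma cinf_inverse (a : cinf U) : (forall x, O x -> a x != 0) ->
  exists b : cinf U, b * a = 1.
Proof.
move=> a0; exists (mk_cinf (smooth_openV oU a0 (cinf_smooth a))).
apply: cinf_eqP => x Ux; rewrite !cinf_evE !cinf_evalE mk_cinfE//.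
by rewrite mulVf// a0.
Qed.

(** The functions [q] and [K] are rational in the derivatives of [F] alone, with
    denominator a power of [gram], and so are smooth for any choice of the
    normal at each point. *)
Lemma curvature_funs : (forall x, O x -> gram x != 0) ->
  exists q K : cinf U, forall x n a b, O x -> curvature_data F x n a b ->
    a ^+ 2 + b ^+ 2 = q x /\ a * b = K x.
Proof.
move=> G0; have [Gi GiG] := cinf_inverse G0.
(* the numerators of [H] and [K] for the form [c], which is the second
   fundamental form scaled by the length of the cross product *)
pose P := c p0 p0 * g p1 p1 - 2 * c p0 p1 * g p0 p1 + c p1 p1 * g p0 p0.
pose D := c p0 p0 * c p1 p1 - c p0 p1 ^+ 2.
exists (P ^+ 2 * Gi ^+ 3 - 2 * (D * Gi ^+ 2)), (D * Gi ^+ 2) => x n a b Ux cd.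
set e := cinf_eval Ux.
have [Gp rH rK] := curvature_data_roots Ux cd; rewrite -/e in Gp rH rK.
rewrite !(second_form_atE n Ux) in rH rK.
pose u i j k := e (cinf_der (space_dir i) (cinf_der (space_dir j) (coord_fun k))).
pose ec i j := - (e c0 * u i j o0 + e c1 * u i j o1 + e c2 * u i j o2).
have ecE i j : e (c (cinf_der (space_dir i)) (cinf_der (space_dir j))) = ec i j.
  by rewrite /c /sff /e !(cinf_evN, cinf_evD) !cinf_evM.
have c0E : e c0 = e (p0 f1) * e (p1 f2) - e (p0 f2) * e (p1 f1).
  by rewrite /c0 /e cinf_evD cinf_evN !cinf_evM.
have c1E : e c1 = e (p0 f2) * e (p1 f0) - e (p0 f0) * e (p1 f2).
  by rewrite /c1 /e cinf_evD cinf_evN !cinf_evM.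
have c2E : e c2 = e (p0 f0) * e (p1 f1) - e (p0 f1) * e (p1 f0).
  by rewrite /c2 /e cinf_evD cinf_evN !cinf_evM.
have gmE d d' : e (g d d') = e (d f0) * e (d' f0) + e (d f1) * e (d' f1)
    + e (d f2) * e (d' f2).
  by rewrite /g /metric /e !cinf_evD !cinf_evM.
have gramE : e gram = e (g p0 p0) * e (g p1 p1) - e (g p0 p1) ^+ 2.
  by rewrite /gram /e cinf_evD cinf_evN cinf_evX cinf_evM.
have [nn nd _ _] := cd.
have nd' k : e (cinf_der (space_dir k) f0) * n 0 o0
    + e (cinf_der (space_dir k) f1) * n 0 o1
    + e (cinf_der (space_dir k) f2) * n 0 o2 = 0.
  by rewrite /e !cinf_evalE !(cinf_der_coord _ _ Ux) -dot3.
have := @unit_normal_products R (e (p0 f0)) (e (p0 f1)) (e (p0 f2))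
  (e (p1 f0)) (e (p1 f1)) (e (p1 f2)) (n 0 o0) (n 0 o1) (n 0 o2).
rewrite -!gmE -gramE => /(_ (lt0r_neq0 Gp)) /(_ _ (nd' 0) (nd' 1)).
rewrite -c0E -c1E -c2E -dot3 => /(_ nn) prod.
have ep i j i' j' : - (n 0 o0 * u i j o0 + n 0 o1 * u i j o1 + n 0 o2 * u i j o2)
    * - (n 0 o0 * u i' j' o0 + n 0 o1 * u i' j' o1 + n 0 o2 * u i' j' o2) * e gram
    = ec i j * ec i' j'.
  rewrite /ec.
  have := prod (u i j o0) (u i j o1) (u i j o2) (u i' j' o0) (u i' j' o1) (u i' j' o2).
  generalize (u i j o0) (u i j o1) (u i j o2) (u i' j' o0) (u i' j' o1)
    (u i' j' o2) (e gram) (e c0) (e c1) (e c2) (n 0 o0) (n 0 o1) (n 0 o2).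
  by move=> x0 x1 x2 y0 y1 y2 dd z0 z1 z2 m0 m1 m2 E; apply: (eq_of_sub_eq E); ring.
have iG : e Gi * e gram = 1 by rewrite /e -cinf_evM GiG cinf_ev1.
have [rS rP] := normalized_curvatures iG rH rK (ep _ _ _ _) (ep _ _ _ _)
  (ep _ _ _ _) (ep _ _ _ _) (ep _ _ _ _) (ep _ _ _ _).
have eP : e P = ec 0 0 * e (g p1 p1) - 2 * ec 0 1 * e (g p0 p1)
    + ec 1 1 * e (g p0 p0).
  rewrite -!ecE /P /e.
  rewrite (cinf_evD Ux (_ - _)) (cinf_evD Ux (c p0 p0 * _)) cinf_evN !cinf_evM.
  by rewrite cinf_ev_nat.
have eD : e D = ec 0 0 * ec 1 1 - ec 0 1 ^+ 2.
  by rewrite -!ecE /D /e cinf_evD cinf_evN cinf_evX cinf_evM.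
rewrite -eP in rS; rewrite -eD in rP; clearbody P D.
rewrite -!(cinf_evalE Ux) -/e.
have -> : e (D * Gi ^+ 2) = a * b by rewrite /e cinf_evM cinf_evX rP.
split=> //.
have -> : e (P ^+ 2 * Gi ^+ 3 - 2 * (D * Gi ^+ 2)) = (a + b) ^+ 2 - 2 * (a * b).
  rewrite /e cinf_evD cinf_evN (cinf_evM Ux (P ^+ 2)) (cinf_evM Ux 2).
  by rewrite (cinf_evM Ux D) !cinf_evX cinf_ev_nat rS rP.
by ring.
Qed.

End CurvatureData.

(** * Smoothness of the normal along the flow *)

Fact cinf_cst_key : unit. Proof. exact: tt. Qed.

Section CinfConstants.
Context {R : realType} {V : normedModType R}.
Variable U : pointed_open V.
Local Notation O := (po_set U).
Let oU := @po_open _ U.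

Definition cinf_cst (r : R) : cinf U :=
  locked_with cinf_cst_key (mk_cinf (smooth_open_cst oU r)).

Lemma cinf_cstE r x : O x -> cinf_cst r x = r.
Proof. by move=> Ox; rewrite /cinf_cst unlock mk_cinfE. Qed.

Lemma cinf_cst_zmod_morphism : zmod_morphism cinf_cst.
Proof.
move=> a b; apply: cinf_eqP => x Ux.
by rewrite cinf_evD cinf_evN !cinf_evalE !cinf_cstE.
Qed.

Lemma cinf_cst_monoid_morphism : monoid_morphism cinf_cst.
Proof.
split=> [|a b]; apply: cinf_eqP => x Ux; first by rewrite cinf_ev1 cinf_evalE cinf_cstE.
by rewrite cinf_evM !cinf_evalE !cinf_cstE.
Qed.

HB.instance Definition _ :=
  GRing.isZmodMorphism.Build R (cinf U) cinf_cst cinf_cst_zmod_morphism.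
HB.instance Definition _ :=
  GRing.isMonoidMorphism.Build R (cinf U) cinf_cst cinf_cst_monoid_morphism.

Lemma cinf_der_cst v r : cinf_der v (cinf_cst r) = 0.
Proof.
apply: cinf_eqP => x Ux; rewrite cinf_ev0 cinf_evalE.
rewrite (cinf_der_eq (f := cst r))// ?derive_cst// => y Oy.
by rewrite cinf_cstE.
Qed.

Lemma cinf_der_linear (a b : R) (v w : V) (z : cinf U) :
  cinf_der (a *: v + b *: w) z
  = cinf_cst a * cinf_der v z + cinf_cst b * cinf_der w z.
Proof.
apply: cinf_eqP => x Ux; rewrite cinf_evD !cinf_evM !cinf_evalE !cinf_cstE//.
have dz := cinf_differentiable z Ux.
by rewrite !cinf_derE// !deriveE// linearD !linearZ.
Qed.

End CinfConstants.

Section Flow.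
Context {R : realType}.
Notation V := ('rV[R]_2 * R)%type.
Variables (U : pointed_open V) (F N : V -> 'rV[R]_3) (l1 l2 : V -> R).
Hypothesis sF : smooth_open (po_set U) F.
Local Notation O := (po_set U).
Hypothesis CD : forall x, O x -> curvature_data F x (N x) (l1 x) (l2 x).
Hypothesis l1_gt0 : forall x, O x -> 0 < l1 x.
Hypothesis l2_gt0 : forall x, O x -> 0 < l2 x.
Hypothesis flow : forall x, O x ->
  'D_time_dir F x = - (l1 x ^+ 2 + l2 x ^+ 2) *: N x.

Local Notation f0 := (coord_fun sF o0).
Local Notation f1 := (coord_fun sF o1).
Local Notation f2 := (coord_fun sF o2).
Local Notation p0 := (@cinf_der R _ U (space_dir 0)).
Local Notation p1 := (@cinf_der R _ U (space_dir 1)).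
Local Notation pt := (@cinf_der R _ U (@time_dir R)).

(** In terms of the mean curvature [H] and the Gauss curvature [K] this is
    [H * (H ^+ 2 - 4 * K) / (2 * K)], a smooth function even at umbilics. *)
Definition pinching (a b : R) : R := (a + b) * (a - b) ^+ 2 / (2 * a * b).

Record flow_funs (n0 n1 n2 H K w : cinf U) : Prop := FlowFuns {
  fg_n0 : forall x, O x -> n0 x = N x 0 o0 ;
  fg_n1 : forall x, O x -> n1 x = N x 0 o1 ;
  fg_n2 : forall x, O x -> n2 x = N x 0 o2 ;
  fg_H : forall x, O x -> H x = l1 x + l2 x ;
  fg_K : forall x, O x -> K x = l1 x * l2 x ;
  fg_w : forall x, O x -> w x = pinching (l1 x) (l2 x) ;
  fg_unit : n0 ^+ 2 + n1 ^+ 2 + n2 ^+ 2 = 1 ;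
  fg_normal0 : n0 * p0 f0 + n1 * p0 f1 + n2 * p0 f2 = 0 ;
  fg_normal1 : n0 * p1 f0 + n1 * p1 f1 + n2 * p1 f2 = 0 ;
  fg_flow0 : pt f0 = - ((H ^+ 2 - 2 * K) * n0) ;
  fg_flow1 : pt f1 = - ((H ^+ 2 - 2 * K) * n1) ;
  fg_flow2 : pt f2 = - ((H ^+ 2 - 2 * K) * n2) ;
  fg_meanE : let g := metric f0 f1 f2 in let h := sff n0 n1 n2 f0 f1 f2 in
    H * (g p0 p0 * g p1 p1 - g p0 p1 ^+ 2)
    = h p0 p0 * g p1 p1 - 2 * h p0 p1 * g p0 p1 + h p1 p1 * g p0 p0 ;
  fg_gaussE : let g := metric f0 f1 f2 in let h := sff n0 n1 n2 f0 f1 f2 in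
    K * (g p0 p0 * g p1 p1 - g p0 p1 ^+ 2)
    = h p0 p0 * h p1 p1 - h p0 p1 ^+ 2 ;
  fg_pinching : 2 * K * w = H * (H ^+ 2 - 4 * K) }.

(** The flow equation determines the normal as minus the velocity over [q],
    where [q] is smooth and positive. This also settles the sign of the second
    fundamental form, and so the smoothness of [H]. *)
Lemma exists_flow_funs : exists n0 n1 n2 H K w, flow_funs n0 n1 n2 H K w.
Proof.
have G0 x : O x -> gram sF x != 0.
  move=> Ox; have [G0 _ _] := curvature_data_roots sF Ox (CD Ox).
  exact: lt0r_neq0.
have [q [K qK]] := curvature_funs G0.
have qE x (Ox : O x) : q x = l1 x ^+ 2 + l2 x ^+ 2 by have [] := qK _ _ _ _ Ox (CD Ox).
have KE x (Ox : O x) : K x = l1 x * l2 x by have [] := qK _ _ _ _ Ox (CD Ox).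
have q0 x (Ox : O x) : q x != 0.
  by rewrite qE// gt_eqF// addr_gt0// exprn_gt0// ?l1_gt0 ?l2_gt0.
have [qi qiq] := cinf_inverse q0.
have qiE x (Ox : O x) : qi x * q x = 1.
  by rewrite -!(cinf_evalE Ox) -cinf_evM qiq cinf_ev1.
have [Gi GiG] := cinf_inverse G0.
have KK0 x (Ox : O x) : (2 * K) x != 0.
  rewrite -(cinf_evalE Ox) cinf_evM cinf_ev_nat cinf_evalE KE//.
  by rewrite gt_eqF// mulr_gt0// mulr_gt0// ?l1_gt0 ?l2_gt0.
have [Ki KiK] := cinf_inverse KK0.
have flowE k x (Ox : O x) : pt (coord_fun sF k) x = - (q x * N x 0 k).
  by rewrite cinf_der_coord// flow// qE// mxE mulNr.
pose n k := - (pt (coord_fun sF k) * qi).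
have nE k x (Ox : O x) : n k x = N x 0 k.
  rewrite -(cinf_evalE Ox) cinf_evN cinf_evM !cinf_evalE flowE//.
  by rewrite mulNr opprK mulrC mulrA qiE// mul1r.
clearbody n.
pose g := metric f0 f1 f2; pose h := sff (n o0) (n o1) (n o2) f0 f1 f2.
pose H := (h p0 p0 * g p1 p1 - 2 * h p0 p1 * g p0 p1 + h p1 p1 * g p0 p0) * Gi.
have hE x (Ox : O x) i j :
    cinf_eval Ox (h (cinf_der (space_dir i)) (cinf_der (space_dir j)))
    = second_form_at F (N x) x i j.
  rewrite (second_form_atE sF (N x) Ox) /h /sff cinf_evN !cinf_evD !cinf_evM.
  by rewrite -!nE// !cinf_evalE.
have eH : H * gram sF
    = h p0 p0 * g p1 p1 - 2 * h p0 p1 * g p0 p1 + h p1 p1 * g p0 p0.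
  by rewrite /H -mulrA GiG mulr1.
have HE x (Ox : O x) : H x = l1 x + l2 x.
  have [Gp rH _] := curvature_data_roots sF Ox (CD Ox).
  rewrite -!hE in rH; clearbody h.
  have D0 : cinf_eval Ox (gram sF) != 0 by exact: lt0r_neq0.
  apply: (mulIf D0); rewrite rH -[H x](cinf_evalE Ox) -(cinf_evM Ox H) eH.
  rewrite (cinf_evD Ox (_ - _)) (cinf_evD Ox (h p0 p0 * _)) cinf_evN.
  by rewrite !cinf_evM cinf_ev_nat.
have eK : K * gram sF = h p0 p0 * h p1 p1 - h p0 p1 ^+ 2.
  apply: cinf_eqP => x Ox; have [_ _ rK] := curvature_data_roots sF Ox (CD Ox).
  rewrite -!hE in rK; clearbody h.
  rewrite (cinf_evM Ox K) (cinf_evD Ox (h p0 p0 * _)) cinf_evN cinf_evX.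
  by rewrite (cinf_evM Ox (h p0 p0)) [cinf_eval Ox K]cinf_evalE KE.
clearbody H.
pose w := Ki * (H * (H ^+ 2 - 4 * K)).
have ew : 2 * K * w = H * (H ^+ 2 - 4 * K) by rewrite /w mulrA (mulrC _ Ki) KiK mul1r.
exists (n o0), (n o1), (n o2), H, K, w; split=> //.
- by move=> x Ox; exact: nE.
- by move=> x Ox; exact: nE.
- by move=> x Ox; exact: nE.
- move=> x Ox; clearbody w; have := congr1 (cinf_eval Ox) ew.
  rewrite (cinf_evM Ox (2 * K)) (cinf_evM Ox 2 K) (cinf_evM Ox H).
  rewrite (cinf_evD Ox (H ^+ 2)) cinf_evN (cinf_evM Ox 4 K) cinf_evX.
  rewrite !cinf_ev_nat !cinf_evalE KE// HE// /pinching.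
  have a0 := l1_gt0 Ox; have b0 := l2_gt0 Ox.
  have K0 : 2 * (l1 x * l2 x) != 0 by rewrite gt_eqF// mulr_gt0// mulr_gt0.
  move=> E; apply: (mulfI K0); rewrite E.
  by field; rewrite !gt_eqF.
- apply: cinf_eqP => x Ox; rewrite !cinf_evD !cinf_evX cinf_ev1 !cinf_evalE !nE//.
  by have [nn _ _ _] := CD Ox; rewrite -[RHS]nn dot3 !expr2.
- apply: cinf_eqP => x Ox; rewrite !cinf_evD !cinf_evM cinf_ev0 !cinf_evalE !nE//.
  have [_ nd _ _] := CD Ox; rewrite -[RHS](nd 0) dot3 !cinf_der_coord//.
  by congr (_ + _ + _); rewrite mulrC.
- apply: cinf_eqP => x Ox; rewrite !cinf_evD !cinf_evM cinf_ev0 !cinf_evalE !nE//.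
  have [_ nd _ _] := CD Ox; rewrite -[RHS](nd 1) dot3 !cinf_der_coord//.
  by congr (_ + _ + _); rewrite mulrC.
- apply: cinf_eqP => x Ox.
  rewrite cinf_evN (cinf_evM Ox (_ - _)) (cinf_evD Ox (H ^+ 2)) cinf_evN.
  rewrite (cinf_evM Ox 2 K) cinf_evX cinf_ev_nat.
  rewrite !cinf_evalE flowE// nE// HE// KE// qE//; congr (- (_ * _)); ring.
- apply: cinf_eqP => x Ox.
  rewrite cinf_evN (cinf_evM Ox (_ - _)) (cinf_evD Ox (H ^+ 2)) cinf_evN.
  rewrite (cinf_evM Ox 2 K) cinf_evX cinf_ev_nat.
  rewrite !cinf_evalE flowE// nE// HE// KE// qE//; congr (- (_ * _)); ring.
- apply: cinf_eqP => x Ox.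
  rewrite cinf_evN (cinf_evM Ox (_ - _)) (cinf_evD Ox (H ^+ 2)) cinf_evN.
  rewrite (cinf_evM Ox 2 K) cinf_evX cinf_ev_nat.
  rewrite !cinf_evalE flowE// nE// HE// KE// qE//; congr (- (_ * _)); ring.
Qed.

End Flow.

(** * The time derivative at a spatial maximum *)

Section LocalEvolution.
Context {R : realType}.
Notation V := ('rV[R]_2 * R)%type.

Definition tangent (F : V -> 'rV[R]_3) (a b : R) (x : V) : 'rV[R]_3 :=
  a *: 'D_(space_dir 0) F x + b *: 'D_(space_dir 1) F x.

(** The Jacobian determinant, along the fields [tangent], of the components of
    [F] along the two tangent vectors at [x0]. *)
Definition jacobian_det (F : V -> 'rV[R]_3) (a1 b1 a2 b2 : R) (x0 x : V) : R :=
  dot (tangent F a1 b1 x0) (tangent F a1 b1 x)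
    * dot (tangent F a2 b2 x0) (tangent F a2 b2 x)
  - dot (tangent F a2 b2 x0) (tangent F a1 b1 x)
    * dot (tangent F a1 b1 x0) (tangent F a2 b2 x).

Section Frame.
Variables (U : pointed_open V) (F N : V -> 'rV[R]_3) (l1 l2 : V -> R).
Hypothesis sF : smooth_open (po_set U) F.
Local Notation O := (po_set U).
Local Notation x0 := (po_pt U).
Hypothesis CD : forall x, O x -> curvature_data F x (N x) (l1 x) (l2 x).
Hypothesis l1_gt0 : forall x, O x -> 0 < l1 x.
Hypothesis l2_gt0 : forall x, O x -> 0 < l2 x.
Hypothesis flow : forall x, O x ->
  'D_time_dir F x = - (l1 x ^+ 2 + l2 x ^+ 2) *: N x.
Let wf x := pinching (l1 x) (l2 x).
Hypothesis w0 : wf x0 != 0.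
Hypothesis wmax : forall a b, \forall s \near (0 : R),
  wf (s *: (a *: space_dir 0 + b *: space_dir 1) + x0) <= wf x0.
Variables (a1 b1 a2 b2 : R).
Let g a b a' b' := sym_bil (first_form_at F x0 0 0) (first_form_at F x0 0 1)
  (first_form_at F x0 1 1) a b a' b'.
Let h a b a' b' := sym_bil (second_form_at F (N x0) x0 0 0)
  (second_form_at F (N x0) x0 0 1) (second_form_at F (N x0) x0 1 1) a b a' b'.
Hypotheses (g11 : g a1 b1 a1 b1 = 1) (g12 : g a1 b1 a2 b2 = 0).
Hypotheses (g22 : g a2 b2 a2 b2 = 1) (h12 : h a1 b1 a2 b2 = 0).
Hypothesis detJ : forall x, O x -> jacobian_det F a1 b1 a2 b2 x0 x != 0.

Local Notation f0 := (coord_fun sF o0).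
Local Notation f1 := (coord_fun sF o1).
Local Notation f2 := (coord_fun sF o2).
Local Notation p0 := (@cinf_der R _ U (space_dir 0)).
Local Notation p1 := (@cinf_der R _ U (space_dir 1)).
Local Notation k := (@cinf_cst R _ U).
Let cf a b := @cst_field R (cinf U) k p0 p1 a b.

Let cf_ev a b i x (Ox : O x) :
  cinf_eval Ox (cf a b (coord_fun sF i)) = tangent F a b x 0 i.
Proof.
rewrite /cf /cst_field cinf_evD !cinf_evM !cinf_evalE !cinf_cstE//.
by rewrite !cinf_der_coord// /tangent mxE; congr (_ + _); rewrite mxE.
Qed.

Let cf_der a b : cf a b = cinf_der (a *: space_dir 0 + b *: space_dir 1).
Proof. by apply/funext => z; rewrite cinf_der_linear. Qed.

Let metric_cf a b a' b' :
  cinf_eval (po_mem U) (metric f0 f1 f2 (cf a b) (cf a' b')) = g a b a' b'.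
Proof.
have [g00 g01 _ g11'] := first_form_atE sF (po_mem U).
transitivity (cinf_eval (po_mem U) (k a * k a' * metric f0 f1 f2 p0 p0
  + (k a * k b' + k b * k a') * metric f0 f1 f2 p0 p1
  + k b * k b' * metric f0 f1 f2 p1 p1)).
  by congr cinf_eval; exact: metric_cst_field.
rewrite /g /sym_bil g00 g01 g11'; move: (metric f0 f1 f2 p0 p0)
  (metric f0 f1 f2 p0 p1) (metric f0 f1 f2 p1 p1) => x y z.
rewrite !cinf_evD !cinf_evM cinf_evD !cinf_evM !(cinf_evalE _ (k _)).
by rewrite !cinf_cstE//; exact: po_mem.
Qed.

Variables (n0 n1 n2 H K w : cinf U).
Hypothesis FG : flow_funs N l1 l2 sF n0 n1 n2 H K w.

Let sff_cf a b a' b' :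
  cinf_eval (po_mem U) (sff n0 n1 n2 f0 f1 f2 (cf a b) (cf a' b')) = h a b a' b'.
Proof.
have hE := second_form_atE sF (N x0) (po_mem U).
have sffE i j : cinf_eval (po_mem U) (sff n0 n1 n2 f0 f1 f2
    (cinf_der (space_dir i)) (cinf_der (space_dir j)))
    = second_form_at F (N x0) x0 i j.
  rewrite hE /sff cinf_evN !cinf_evD !cinf_evM.
  rewrite !(cinf_evalE _ n0) !(cinf_evalE _ n1) !(cinf_evalE _ n2).
  by rewrite (fg_n0 FG (po_mem U)) (fg_n1 FG (po_mem U)) (fg_n2 FG (po_mem U)).
transitivity (cinf_eval (po_mem U) (k a * k a' * sff n0 n1 n2 f0 f1 f2 p0 p0
  + (k a * k b' + k b * k a') * sff n0 n1 n2 f0 f1 f2 p0 p1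
  + k b * k b' * sff n0 n1 n2 f0 f1 f2 p1 p1)).
  congr cinf_eval.
  exact: (@sff_cst_field R (cinf U) k p0 p1 (cinf_der_derivation _ _)
    (cinf_der_derivation _ _) (cinf_der_comm _ _) (cinf_der_cst _ _)
    (cinf_der_cst _ _)).
rewrite /h /sym_bil -!sffE; move: (sff n0 n1 n2 f0 f1 f2 p0 p0)
  (sff n0 n1 n2 f0 f1 f2 p0 p1) (sff n0 n1 n2 f0 f1 f2 p1 p1) => x y z.
rewrite !cinf_evD !cinf_evM cinf_evD !cinf_evM !(cinf_evalE _ (k _)).
by rewrite !cinf_cstE//; exact: po_mem.
Qed.

Let jac : cinf U :=
  cf a1 b1 (dot_cst k (cinf_eval (po_mem U) (cf a1 b1 f0))
    (cinf_eval (po_mem U) (cf a1 b1 f1)) (cinf_eval (po_mem U) (cf a1 b1 f2)) f0 f1 f2)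
  * cf a2 b2 (dot_cst k (cinf_eval (po_mem U) (cf a2 b2 f0))
    (cinf_eval (po_mem U) (cf a2 b2 f1)) (cinf_eval (po_mem U) (cf a2 b2 f2)) f0 f1 f2)
  - cf a1 b1 (dot_cst k (cinf_eval (po_mem U) (cf a2 b2 f0))
    (cinf_eval (po_mem U) (cf a2 b2 f1)) (cinf_eval (po_mem U) (cf a2 b2 f2)) f0 f1 f2)
  * cf a2 b2 (dot_cst k (cinf_eval (po_mem U) (cf a1 b1 f0))
    (cinf_eval (po_mem U) (cf a1 b1 f1)) (cinf_eval (po_mem U) (cf a1 b1 f2)) f0 f1 f2).

Let jacE x (Ox : O x) : jac x = jacobian_det F a1 b1 a2 b2 x0 x.
Proof.
have rE a b a' b' : cinf_eval Ox (cf a b (dot_cst k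
    (cinf_eval (po_mem U) (cf a' b' f0)) (cinf_eval (po_mem U) (cf a' b' f1))
    (cinf_eval (po_mem U) (cf a' b' f2)) f0 f1 f2))
    = dot (tangent F a' b' x0) (tangent F a b x).
  rewrite cf_der der_dot_cst; last first.
  - exact: cinf_der_cst.
  - exact: cinf_der_derivation.
  rewrite -cf_der !cf_ev /dot_cst 2!cinf_evD 3!cinf_evM !cf_ev dot3.
  by rewrite !(cinf_evalE _ (k _)) !cinf_cstE.
rewrite -(cinf_evalE Ox) /jac cinf_evD cinf_evN.
rewrite (cinf_evM Ox (cf a1 b1 _)) (cinf_evM Ox (cf a1 b1 _)).
by rewrite !rE.
Qed.

(** [frame_max_principle] in the ring of smooth functions on [U], when [U] is so
    small that the components of [F] in the tangent plane are coordinates. *)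
Lemma pinching_derivative_frame :
  derivable wf x0 time_dir /\ 'D_time_dir wf x0 <= 0.
Proof.
have wE x : O x -> w x = wf x by exact: (fg_w FG).
have nw : {near x0, (w : V -> R) =1 wf}.
  by apply: (open_near_eq (@po_open _ U)) wE; exact: po_mem.
split.
  by apply: near_eq_derivable nw _; apply/diff_derivable/cinf_differentiable/po_mem.
rewrite -(near_eq_derive time_dir nw) -cinf_derE; last exact: po_mem.
have jac0 x : O x -> jac x != 0 by move=> Ox; rewrite jacE//; exact: detJ.
have [j jJ] := cinf_inverse jac0.
have wmx a b : \forall s \near (0 : R),
    w (s *: (a *: space_dir 0 + b *: space_dir 1) + x0) <= w x0.
  have near_O := line_near (a *: space_dir 0 + b *: space_dir 1)
    (@po_open _ U) (po_mem U).
  near=> s; rewrite !wE; [|exact: po_mem|by near: s].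
  by near: s; exact: wmax.
have [w11 w12] := cinf_second_derivative_test (po_mem U) (wmx a1 b1).
have [w21 w22] := cinf_second_derivative_test (po_mem U) (wmx a2 b2).
rewrite -cf_der in w11 w12; rewrite -cf_der in w21 w22.
have D0 := @cinf_der_derivation R _ U (space_dir 0).
have D1 := @cinf_der_derivation R _ U (space_dir 1).
have Dt := @cinf_der_derivation R _ U time_dir.
apply: (@frame_max_principle R (cinf U) (cinf_eval (po_mem U)) k _
  p0 p1 (cinf_der time_dir) D0 D1 Dt (cinf_der_comm _ _) (cinf_der_comm _ _)
  (cinf_der_comm _ _) (cinf_der_cst _ _) (cinf_der_cst _ _) (cinf_der_cst _ _)
  f0 f1 f2 n0 n1 n2 H K w (fg_unit FG) (fg_normal0 FG) (fg_normal1 FG)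
  (fg_flow0 FG) (fg_flow1 FG) (fg_flow2 FG) (fg_meanE FG) (fg_gaussE FG)
  (fg_pinching FG) a1 b1 a2 b2 _ _ _ _ j jJ _ _ _ w11 w21 w12 w22).
- by move=> r; exact: (cinf_cstE _ (po_mem U)).
- by rewrite -g11; exact: metric_cf.
- by rewrite -g12; exact: metric_cf.
- by rewrite -g22; exact: metric_cf.
- by rewrite -h12; exact: sff_cf.
- have P : 0 < cinf_eval (po_mem U) H.
    rewrite cinf_evalE (fg_H FG (po_mem U)).
    by rewrite addr_gt0// ?l1_gt0 ?l2_gt0//; exact: po_mem.
  exact: P.
- have P : 0 < cinf_eval (po_mem U) K.
    rewrite cinf_evalE (fg_K FG (po_mem U)).
    by rewrite mulr_gt0// ?l1_gt0 ?l2_gt0//; exact: po_mem.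
  exact: P.
- have P : cinf_eval (po_mem U) w != 0.
    by rewrite cinf_evalE (wE _ (po_mem U)).
  exact: P.
Unshelve. all: by end_near. Qed.

End Frame.

End LocalEvolution.

Lemma gram_matrix_gt0 (R : realType) (r : 'I_2 -> 'rV[R]_3) :
  row_free (\matrix_(k < 2) r k) ->
  let g : 'M[R]_2 := \matrix_(i, j) dot (r i) (r j) in
  0 < g 0 0 /\ 0 < g 0 0 * g 1 1 - g 0 1 ^+ 2.
Proof.
move=> /row_free_gram_gt0 + g; rewrite /g !mxE.
have -> : dot (r 1) (r 0) = dot (r 0) (r 1) by apply: eq_bigr => i _; rewrite mulrC.
rewrite -expr2 => d0; split=> //.
rewrite lt_neqAle; apply/andP; split; last first.
  by rewrite dot3 !addr_ge0// -expr2 sqr_ge0.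
apply: contraTneq d0 => <-.
by rewrite mul0r sub0r oppr_gt0 -leNgt sqr_ge0.
Qed.

Section SpatialMaximum.
Context {R : realType}.
Notation V := ('rV[R]_2 * R)%type.

Lemma continuous_dot (e : 'rV[R]_3) (G : V -> 'rV[R]_3) (x : V) :
  {for x, continuous G} -> {for x, continuous (fun y => dot e (G y))}.
Proof.
move=> cG.
have c (k : 'I_3) : {for x, continuous (fun y => G y 0 k)}.
  exact: (continuous_comp cG (@coord_continuous R 1 3 0 k (G x))).
rewrite (_ : (fun y => dot e (G y)) =
  (fun y => e 0 o0 * G y 0 o0 + e 0 o1 * G y 0 o1 + e 0 o2 * G y 0 o2)); last first.
  by apply/funext => y; rewrite dot3.
by apply: cvgD; [apply: cvgD|]; apply: cvgM; (try exact: cvg_cst); exact: c.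
Qed.

Lemma continuous_tangent (O : set V) (F : V -> 'rV[R]_3) a b x :
  smooth_open O F -> O x -> {for x, continuous (tangent F a b)}.
Proof.
move=> sF Ox; rewrite /tangent.
have c i : {for x, continuous (fun y => 'D_(space_dir i) F y)}.
  apply: differentiable_continuous.
  exact: (smooth_open_differentiable (smooth_open_derive (space_dir i) sF)).
exact: (cvgD (cvgZ (cvg_cst a) (c 0)) (cvgZ (cvg_cst b) (c 1))).
Qed.

Lemma dot_tangent (F : V -> 'rV[R]_3) a b a' b' x :
  dot (tangent F a b x) (tangent F a' b' x)
  = sym_bil (first_form_at F x 0 0) (first_form_at F x 0 1) (first_form_at F x 1 1)
      a b a' b'.
Proof.
have E i j : first_form_at F x i j
    = dot ('D_(space_dir i) F x) ('D_(space_dir j) F x) by rewrite mxE.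
rewrite /sym_bil !E /tangent; move: ('D_(space_dir 0) F x) ('D_(space_dir 1) F x).
move=> v w; rewrite !dot3 !mxE.
by move: (v 0 o0) (v 0 o1) (v 0 o2) (w 0 o0) (w 0 o1) (w 0 o2) => *; ring.
Qed.

(** The directions come from [simultaneous_diagonalization] at [x0]. The
    Jacobian determinant is one at [x0], so it is nonzero on a smaller
    neighbourhood, where [pinching_derivative_frame] applies. *)
Lemma pinching_derivative_le0 (O : set V) (x0 : V) (F N : V -> 'rV[R]_3)
    (l1 l2 : V -> R) :
  open O -> O x0 -> smooth_open O F ->
  (forall x, O x -> curvature_data F x (N x) (l1 x) (l2 x)) ->
  (forall x, O x -> 0 < l1 x) -> (forall x, O x -> 0 < l2 x) ->
  (forall x, O x -> 'D_time_dir F x = - (l1 x ^+ 2 + l2 x ^+ 2) *: N x) ->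
  let wf x := pinching (l1 x) (l2 x) in
  wf x0 != 0 ->
  (forall a b, \forall s \near (0 : R),
    wf (s *: (a *: space_dir 0 + b *: space_dir 1) + x0) <= wf x0) ->
  derivable wf x0 time_dir /\ 'D_time_dir wf x0 <= 0.
Proof.
move=> oO Ox0 sF CD l10 l20 flow wf w0 wmax.
have [g00 gram0] : 0 < first_form_at F x0 0 0 /\
    0 < first_form_at F x0 0 0 * first_form_at F x0 1 1
        - first_form_at F x0 0 1 ^+ 2 := gram_matrix_gt0 (cd_free (CD _ Ox0)).
have [a1 [b1 [a2 [b2 [g11 g12 g22 h12]]]]] := simultaneous_diagonalization
  (second_form_at F (N x0) x0 0 0) (second_form_at F (N x0) x0 0 1)
  (second_form_at F (N x0) x0 1 1) g00 gram0.
pose O' : set V := [set x | O x /\ jacobian_det F a1 b1 a2 b2 x0 x != 0].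
have oO' : open O'.
  rewrite openE => x [Ox jx].
  have cj : {for x, continuous (jacobian_det F a1 b1 a2 b2 x0)}.
    have ct a b := @continuous_tangent _ F a b _ sF Ox.
    by apply: cvgB; apply: cvgM; apply: continuous_dot; exact: ct.
  exact: (filterI (open_nbhs_nbhs (conj oO Ox)) (cvgr_neq0 _ cj jx)).
have O'x0 : O' x0.
  split=> //; rewrite /jacobian_det !dot_tangent g11 g22 g12 mulr0 subr0 mulr1.
  exact: oner_neq0.
pose U := PointedOpen oO' O'x0.
have sF' : smooth_open (po_set U) F by move=> vs x [Ox _]; exact: sF.
have CD' x : po_set U x -> curvature_data F x (N x) (l1 x) (l2 x).
  by move=> [Ox _]; exact: CD.
have l10' x : po_set U x -> 0 < l1 x by move=> [Ox _]; exact: l10.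
have l20' x : po_set U x -> 0 < l2 x by move=> [Ox _]; exact: l20.
have flow' x : po_set U x -> 'D_time_dir F x = - (l1 x ^+ 2 + l2 x ^+ 2) *: N x.
  by move=> [Ox _]; exact: flow.
have [n0 [n1 [n2 [H [K [w FG]]]]]] := exists_flow_funs sF' CD' l10' l20' flow'.
apply: (pinching_derivative_frame l10' l20' w0 wmax g11 g12 g22 h12 _ FG).
by move=> x [].
Qed.

End SpatialMaximum.

(** * Time slices of a parametrization *)

Section Slices.
Context {R : realType}.
Notation V := ('rV[R]_2 * R)%type.
Implicit Types F G : V -> 'rV[R]_3.

Lemma derive_slice F (i : 'I_2) (u : 'rV[R]_2) (t : R) :
  'D_(space_dir i) F (u, t) = 'D_(delta_mx 0 i) (fun u' => F (u', t)) u.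
Proof.
rewrite /derive (_ : (fun h : R => h^-1 *: ((F \o shift (u, t)) (h *: space_dir i)
      - F (u, t))) = (fun h : R => h^-1 *: (((fun u' => F (u', t)) \o shift u)
        (h *: delta_mx 0 i) - F (u, t))))//.
apply/funext => h /=; congr (_ *: (F _ - _)).
by rewrite /space_dir; congr (_, _); rewrite /= scaler0 add0r.
Qed.

Lemma partial_slice F (i : 'I_2) u t :
  partial (fun u' => F (u', t)) i u = 'D_(space_dir i) F (u, t).
Proof. by rewrite derive_slice. Qed.

Lemma near_eq_partial (Y Z : 'rV[R]_2 -> 'rV[R]_3) (W : set 'rV[R]_2) i u :
  open W -> W u -> (forall u', W u' -> Y u' = Z u') -> partial Y i u = partial Z i u.
Proof.
move=> oW Wu YZ; apply: near_eq_derive.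
by apply: filterS (open_nbhs_nbhs (conj oW Wu)) => u' /YZ.
Qed.

(** The forms only involve derivatives in the space directions, so it is enough
    that [F] extends the surface at the single time [t]. *)
Lemma curvature_data_chart F (Y : 'rV[R]_2 -> 'rV[R]_3) (W : set 'rV[R]_2)
    (u : 'rV[R]_2) (t : R) (n : 'rV[R]_3) (a b : R) :
  open W -> W u -> (forall u', W u' -> F (u', t) = Y u') ->
  dot n n = 1 -> (forall k, dot (partial Y k u) n = 0) ->
  row_free (\matrix_(k < 2) partial Y k u) ->
  char_poly (second_form Y n u *m invmx (first_form Y u))
    = ('X - a%:P) * ('X - b%:P) ->
  curvature_data F (u, t) n a b.
Proof.
move=> oW Wu FY nn nd fr cp.
have p1 i u' : W u' -> 'D_(space_dir i) F (u', t) = partial Y i u'.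
  by move=> Wu'; rewrite -partial_slice; exact: near_eq_partial FY.
have p2 i j : 'D_(space_dir i) (fun x => 'D_(space_dir j) F x) (u, t)
    = partial (partial Y j) i u.
  rewrite derive_slice; apply: near_eq_partial oW Wu _ => u' Wu'.
  exact: p1.
have ff : first_form_at F (u, t) = first_form Y u.
  apply/matrixP => i j.
  transitivity (dot ('D_(space_dir i) F (u, t)) ('D_(space_dir j) F (u, t))).
    exact: mxE.
  by rewrite (p1 i u Wu) (p1 j u Wu); exact/esym/mxE.
have sf : second_form_at F n (u, t) = second_form Y n u.
  apply/matrixP => i j.
  transitivity (- dot ('D_(space_dir i) (fun x => 'D_(space_dir j) F x) (u, t)) n).
    exact: mxE.
  by rewrite (p2 i j); exact/esym/mxE.
have fm : \matrix_(k < 2) 'D_(space_dir k) F (u, t) = \matrix_(k < 2) partial Y k u.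
  apply/matrixP => k j; transitivity ('D_(space_dir k) F (u, t) 0 j).
    exact: mxE.
  by rewrite (p1 k u Wu); exact/esym/mxE.
split.
- exact: nn.
- by move=> k; rewrite (p1 k u Wu); exact: nd.
- by rewrite fm; exact: fr.
- by rewrite ff sf; exact: cp.
Qed.

Lemma derivative_within_time F (I : set R) (u : 'rV[R]_2) (t : R) v :
  nbhs t I -> derivative_within I (fun s => F (u, s)) t v ->
  'D_time_dir F (u, t) = v.
Proof.
move=> It dF; rewrite /derive; apply: cvg_lim => //.
have shift : (fun h : R => h + t) @ 0^' --> within I t^'.
  move=> P wP.
  have c : {for (0 : R), continuous (fun h : R => h + t)}.
    by apply: cvgD; [exact: cvg_id|exact: cvg_cst].
  have wP' : \forall y \near 0 + t, y != t -> I y -> P y by rewrite add0r.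
  have It' : \forall y \near 0 + t, I y by rewrite add0r.
  have Q : \forall h \near (0 : R), (h + t != t -> I (h + t) -> P (h + t)) /\ I (h + t).
    exact: (filterI (c _ wP') (c _ It')).
  apply: filterS Q => h [hP hI] h0; apply: hP => //.
  by rewrite -subr_eq0 addrK.
have := cvg_comp _ _ shift dF; apply: cvg_trans; apply: near_eq_cvg.
near=> h; rewrite /= addrK; congr (_ *: (F _ - _)).
by congr (_, _); rewrite /= ?scaler0 ?add0r// /GRing.scale /= mulr1.
Unshelve. all: by end_near. Qed.

Lemma derive_le0_left (f : V -> R) (x0 : V) (e : R) :
  derivable f x0 time_dir -> 'D_time_dir f x0 <= 0 -> 0 < e ->
  \forall s \near x0.2^'-, f x0 - e * (x0.2 - s) <= f (x0.1, s).
Proof.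
move=> df Df e0.
have De : 'D_time_dir f x0 < e by exact: le_lt_trans e0.
have D : nbhs (0 : R) [set h | h != 0 ->
  h^-1 *: (f (h *: time_dir + x0) - f x0) < e].
  exact: (cvgr_lt _ df _ De).
have /nbhs_normP[d /= d0 dP] := D.
have D' : nbhs x0.2 [set s | s < x0.2 -> f x0 - e * (x0.2 - s) <= f (x0.1, s)].
  apply/nbhs_normP; exists d => //= s; rewrite /ball_ /= => sd st.
  have := dP (s - x0.2); rewrite /ball_ /= sub0r normrN distrC => /(_ sd).
  have st0 : s - x0.2 < 0 by rewrite subr_lt0.
  move=> /(_ (ltr0_neq0 st0)).
  have -> : (s - x0.2) *: time_dir + x0 = (x0.1, s).
    rewrite [x0 in LHS]surjective_pairing; congr (_, _).
      by rewrite /= scaler0 add0r.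
    by rewrite /= /GRing.scale /= mulr1 subrK.
  rewrite /GRing.scale /= mulrC ltr_ndivrMr// => H.
  lra.
exact: D'.
Qed.

End Slices.

(** * Monotonicity of the maximum *)

(** Fix [e > 0] and let [r0] be the infimum of the [r] between [s] and [t] with
    [m t - e * (t - r) <= m r]. Upper semicontinuity shows that [r0] is one of
    them, and the left estimate at [r0] gives smaller ones unless [r0 = s]. Then
    let [e] tend to zero. *)
Lemma nonincreasing_of_left_estimate (R : realType) (I : set R) (m : R -> R)
    (s t : R) :
  (forall r, s <= r -> r <= t -> I r) ->
  (forall r e, s <= r -> r <= t -> 0 < e ->
     \forall x \near r, I x -> m x <= m r + e) ->
  (forall r e, s < r -> r <= t -> 0 < e ->
     \forall x \near r^'-, m r - e * (r - x) <= m x) ->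
  s <= t -> m t <= m s.
Proof.
move=> sub usc left st; apply/ler_addgt0Pr => e' e'0.
pose e := e' / (t - s + 1).
have ts0 : 0 < t - s + 1 by rewrite ltr_wpDl// subr_ge0.
have e0 : 0 < e by rewrite divr_gt0.
pose E := [set r | [/\ s <= r, r <= t & m t - e * (t - r) <= m r]].
have Et : E t by split=> //; rewrite subrr mulr0 subr0.
have lbE : lbound E s by move=> r [].
have hiE : has_inf E by split; [exists t|exists s].
pose r0 := inf E.
have sr0 : s <= r0 by apply: lb_le_inf => //; exists t.
have r0t : r0 <= t by apply: ge_inf => //; exists s.
have Er0 : m t - e * (t - r0) <= m r0.
  apply/ler_addgt0Pr => d d0.
  have /nbhs_normP[h /= h0 hP] := usc r0 d sr0 r0t d0.
  have [r Er rh] := inf_adherent h0 hiE.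
  have r0r : r0 <= r by apply: ge_inf => //; exists s.
  have [sr rt mr] := Er.
  have mr0 : m r <= m r0 + d.
    apply: hP; last exact: sub.
    rewrite /ball_ /= distrC ger0_norm ?subr_ge0//.
    by rewrite ltrBlDl.
  apply: le_trans mr0; apply: le_trans mr.
  by rewrite lerD2l lerN2 ler_pM2l// lerD2l lerN2.
have r0s : r0 = s.
  apply/eqP; rewrite eq_le sr0 andbT leNgt; apply/negP => sr.
  have F := left r0 e sr r0t e0.
  have [x [[xr xs] H]] := filter_ex
    (filterI (filterI (nbhs_left_lt r0) (nbhs_left_ge sr)) F).
  have Ex : E x.
    split=> //; first by rewrite (le_trans (ltW xr)).
    apply: le_trans H.
    apply: le_trans (lerB Er0 (lexx _)).
    by rewrite -subr_ge0 (_ : _ - _ = 0)//; ring.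
  have : r0 <= x by apply: ge_inf => //; exists s.
  by rewrite leNgt xr.
rewrite r0s in Er0; rewrite -lerBlDr; apply: le_trans Er0.
rewrite lerD2l lerN2 /e mulrAC ler_pdivrMr// ler_pM2l//.
by rewrite lerDl.
Qed.

Lemma pinching_ge0 (R : realType) (a b : R) : 0 < a -> 0 < b -> 0 <= pinching a b.
Proof.
move=> /ltW a0 /ltW b0; rewrite /pinching.
by rewrite !(divr_ge0, sqr_ge0, mulr_ge0, addr_ge0).
Qed.

Lemma pinchingE (R : realType) (a b : R) : 0 < a -> 0 < b ->
  let H := Num.sqrt (a ^+ 2 + b ^+ 2 + 2 * (a * b)) in
  pinching a b = H * (H ^+ 2 - 4 * (a * b)) / (2 * (a * b)).
Proof.
move=> a0 b0 H; have -> : H = a + b.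
  rewrite /H (_ : _ + _ = (a + b) ^+ 2); last by ring.
  by rewrite sqrtr_sqr gtr0_norm// addr_gt0.
by rewrite /pinching; field; rewrite !gt_eqF.
Qed.

Lemma gram_atE (R : realType) (U : pointed_open ('rV[R]_2 * R)%type)
  (F : ('rV[R]_2 * R)%type -> 'rV[R]_3) (sF : smooth_open (po_set U) F) x :
  po_set U x -> gram sF x = first_form_at F x 0 0 * first_form_at F x 1 1
    - first_form_at F x 0 1 * first_form_at F x 1 0.
Proof.
move=> Ox; have [-> -> -> ->] := first_form_atE sF Ox.
by rewrite -(cinf_evalE Ox) /gram cinf_evD cinf_evN cinf_evX cinf_evM -expr2.
Qed.

Lemma open_EFin_lt (R : realType) (T : \bar R) : open [set t : R | (t%:E < T)%E].
Proof.
case: T => [r| |].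
- rewrite (_ : [set t | _] = [set t | t < r]); first exact: open_lt.
  by apply/seteqP; split=> t /=; rewrite lte_fin.
- rewrite (_ : [set t | _] = setT); first exact: openT.
  by apply/seteqP; split=> // t _ /=; rewrite ltry.
- rewrite (_ : [set t | _] = set0); first exact: open0.
  by apply/seteqP; split=> // t /=.
Qed.

Section ConvexFlow.
Variables (R : realType) (S : topologicalType) (A : smooth_atlas R S).
Variables (T : \bar R) (X nu : S -> R -> 'rV[R]_3) (l1 l2 : S -> R -> R).
Notation V := ('rV[R]_2 * R)%type.
Hypothesis HX : smooth_family A T X.
Hypothesis Hemb : forall t, time_interval T t -> embedding A (X ^~ t).
Hypothesis Hnu : forall p t, time_interval T t ->
  outer_unit_normal A (X ^~ t) p (nu p t).
Hypothesis Hl : forall p t, time_interval T t ->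
  principal_curvatures A (X ^~ t) p (nu p t) (l1 p t) (l2 p t).
Hypothesis Hconv : forall p t, time_interval T t -> 0 < l1 p t /\ 0 < l2 p t.
Hypothesis Hflow : forall p t, time_interval T t ->
  derivative_within (time_interval T) (X p) t
    (- normA2 (l1 p t) (l2 p t) *: nu p t).

Let wS p t := pinching (l1 p t) (l2 p t).

Lemma chart_curvature_data i (G : V -> 'rV[R]_3) (W : set 'rV[R]_2) u t :
  open W -> W u -> (forall u', W u' -> G (u', t) = X (par A i u') t) ->
  dom A i u -> time_interval T t ->
  curvature_data G (u, t) (nu (par A i u) t) (l1 (par A i u) t) (l2 (par A i u) t).
Proof.
move=> oW Wu GX du It.
have [nn nd _] := Hnu (par A i u) It.
apply: (curvature_data_chart oW Wu GX nn).
- by move=> k; exact: nd.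
- by have [_] := Hemb It; exact.
- have H : principal_curvatures A (X ^~ t) (par A i u) (nu (par A i u) t)
    (l1 (par A i u) t) (l2 (par A i u) t) by exact: Hl.
  exact: (H i u du erefl).
Qed.

(** At the initial time, the parametrization is only the restriction of a smooth
    map [G]. At the points of the domain the space derivatives of [G] are those
    of the surface, so [curvature_funs] for [G] shows that the pinching
    quantity is the restriction of a continuous function. *)
Lemma pinching_near i u0 t0 e : dom A i u0 -> time_interval T t0 -> 0 < e ->
  \forall x \near ((u0, t0) : V), dom A i x.1 -> time_interval T x.2 ->
    `|wS (par A i x.1) x.2 - wS (par A i u0) t0| < e.
Proof.
move=> du0 It0 e0; set x0 : V := (u0, t0).
have Dx0 : (dom A i `*` time_interval T) x0 by split.
have [Om [G [oO Ox0 sG GF]]] := HX Dx0.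
have cdG x : Om x -> dom A i x.1 -> time_interval T x.2 ->
    curvature_data G x (nu (par A i x.1) x.2) (l1 (par A i x.1) x.2)
      (l2 (par A i x.1) x.2).
  case: x => u t /= Ox du It.
  have oW : open [set u' | Om (u', t) /\ dom A i u'].
    apply: openI; last exact: dom_open.
    have c : continuous (fun u' : 'rV[R]_2 => (u', t)).
      move=> u' B [[P Q] /= [P0 Q0] PQ]; apply: filterS P0 => v Pv.
      by apply: PQ; split=> //=; exact: nbhs_singleton Q0.
    exact: (open_comp (fun u' _ => c u')).
  apply: (chart_curvature_data oW) => // u' [Ou' du'].
  by rewrite GF.
have [U' [UO U'x0 G0]] : exists U : pointed_open V,
    [/\ po_set U `<=` Om, po_set U x0 &
      forall x, po_set U x -> first_form_at G x 0 0 * first_form_at G x 1 1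
        - first_form_at G x 0 1 * first_form_at G x 1 0 != 0].
  pose U1 := PointedOpen oO Ox0; have sG1 : smooth_open (po_set U1) G := sG.
  have oO' : open [set x | Om x /\ gram sG1 x != 0].
    rewrite openE => x [Ox jx].
    have c : {for x, continuous (gram sG1)}.
      exact/differentiable_continuous/cinf_differentiable.
    exact: (filterI (open_nbhs_nbhs (conj oO Ox)) (cvgr_neq0 _ c jx)).
  have [g0 _ _] := curvature_data_roots sG1 (Ox0 : po_set U1 x0) (cdG _ Ox0 du0 It0).
  exists (PointedOpen oO' (conj Ox0 (lt0r_neq0 g0))); split.
  - by move=> x [].
  - by split=> //; exact: (lt0r_neq0 g0).
  - by move=> x [Ox]; rewrite (gram_atE sG1).
have sG' : smooth_open (po_set U') G by move=> vs x Ux; apply: sG; exact: UO.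
have [|q [K qK]] := @curvature_funs _ U' G sG'.
  by move=> x Ux; rewrite gram_atE//; exact: G0.
(* [q + 2 * K] is the square of the mean curvature, so no normal enters *)
pose Hh (x : V) := Num.sqrt (q x + 2 * K x).
pose wh (x : V) := Hh x * (Hh x ^+ 2 - 4 * K x) / (2 * K x).
have wE x : po_set U' x -> dom A i x.1 -> time_interval T x.2 ->
    wS (par A i x.1) x.2 = wh x /\ 0 < K x.
  move=> Ux dx Ix; have [a0 b0] := Hconv (par A i x.1) Ix.
  have [eq eK] := qK _ _ _ _ Ux (cdG _ (UO _ Ux) dx Ix).
  by rewrite /wS pinchingE// eq eK; split=> //; rewrite -eK mulr_gt0.
have [w0 K0] := wE x0 U'x0 du0 It0.
have cq : {for x0, continuous (q : V -> R)}.
  exact/differentiable_continuous/cinf_differentiable.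
have cK : {for x0, continuous (K : V -> R)}.
  exact/differentiable_continuous/cinf_differentiable.
have c2K c : {for x0, continuous (fun x => c * K x)}.
  by apply: cvgM => //; exact: cvg_cst.
have cH : {for x0, continuous Hh}.
  apply: (@continuous_comp _ _ _ (fun x => q x + 2 * K x) Num.sqrt).
    by apply: cvgD => //; exact: c2K.
  exact: sqrt_continuous.
have cw : {for x0, continuous wh}.
  apply: cvgM; [apply: cvgM => //; apply: cvgB; [|exact: c2K]|].
    by apply: cvgM.
  by apply: cvgV; [rewrite gt_eqF// mulr_gt0|exact: c2K].
have N1 := open_nbhs_nbhs (conj (@po_open _ U') U'x0).
have N2 : \forall x \near x0, `|wh x0 - wh x| < e.
  by move/cvgrPdist_lt : cw; apply.
apply: filterS (filterI N1 N2) => x [Ux dw] dx Ix.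
by rewrite (wE x Ux dx Ix).1 w0 distrC.
Qed.

Lemma pinching_near_surface p0 t0 e : time_interval T t0 -> 0 < e ->
  \forall p \near p0 & t \near t0, time_interval T t ->
    `|wS p t - wS p0 t0| < e.
Proof.
move=> It0 e0; have [i [u0 du0 <-]] := par_cover A p0.
have [[P Q] /= [P0 Q0] PQ] := pinching_near du0 It0 e0.
have [B [[oB Bu0] BP]] : exists B, open_nbhs u0 B /\ B `<=` P.
  by move: P0; rewrite nbhsE => -[B oB BP]; exists B.
exists (par A i @` (B `&` dom A i), Q).
  split=> //=; apply: open_nbhs_nbhs; split.
    by apply: par_open => [|u []//]; apply: openI => //; exact: dom_open.
  by exists u0.
move=> [p t] /= [[u [Bu du] <-] Qt] It.
by apply: (PQ (u, t)) => //; split=> //; exact: BP.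
Qed.

Lemma interior_chart i u0 t0 : dom A i u0 -> time_interval T t0 -> 0 < t0 ->
  exists Om : set V, [/\ open Om, Om (u0, t0),
    smooth_open Om (fun x => X (par A i x.1) x.2) &
    forall x, Om x -> [/\ dom A i x.1, time_interval T x.2 &
      nbhs x.2 (time_interval T)]].
Proof.
move=> du0 It0 t00.
have Dx0 : (dom A i `*` time_interval T) (u0, t0) by split.
have [Om1 [G [oO1 O1x0 sG GF]]] := HX Dx0.
pose J : set R := [set t | 0 < t /\ (t%:E < T)%E].
have oJ : open J by apply: openI; [exact: open_gt|exact: open_EFin_lt].
have JI : J `<=` time_interval T by move=> t [t1 t2]; split=> //; exact: ltW.
have [_ t0T] := It0.
pose Om : set V := Om1 `&` (dom A i `*` J).
have oO : open Om.
  apply: openI => //; rewrite openE => -[u t] /= [du Jt].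
  exists (dom A i, J) => //; split; apply: open_nbhs_nbhs; split=> //.
  exact: dom_open.
exists Om; split=> //.
- have sG' : smooth_open Om G by move=> vs x [Ox _]; exact: sG.
  apply: (eq_smooth_open oO _ sG') => x [Ox [dx Jx]].
  by apply: GF => //; split=> //; exact: JI.
- move=> x [_ [dx Jx]]; split=> //; first exact: JI.
  by apply: filterS JI _; exact: open_nbhs_nbhs.
Qed.

(** [pinching_derivative_le0] in a chart around [p]: the maximum is global on
    the surface, so it is also one along each line of the chart. *)
Lemma pinching_left p t e : time_interval T t -> 0 < t ->
  wS p t != 0 -> (forall p', wS p' t <= wS p t) -> 0 < e ->
  \forall s \near t^'-, wS p t - e * (t - s) <= wS p s.
Proof.
move=> It t0 w0 wmax e0; have [i [u0 du0 pu]] := par_cover A p.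
have [Om [oO Ox0 sF OD]] := interior_chart du0 It t0.
set F := (fun x : V => X (par A i x.1) x.2) in sF.
pose N (x : V) := nu (par A i x.1) x.2.
pose L1 (x : V) := l1 (par A i x.1) x.2.
pose L2 (x : V) := l2 (par A i x.1) x.2.
have CD x : Om x -> curvature_data F x (N x) (L1 x) (L2 x).
  case: x => u s Ox; have [du Is _] := OD _ Ox.
  have oW : open (dom A i) by exact: dom_open.
  exact: (@chart_curvature_data i F (dom A i) u s oW du (fun _ _ => erefl) du Is).
have L10 x : Om x -> 0 < L1 x.
  by move=> /OD[_ Is _]; have [] := Hconv (par A i x.1) Is.
have L20 x : Om x -> 0 < L2 x.
  by move=> /OD[_ Is _]; have [] := Hconv (par A i x.1) Is.
have flow x : Om x -> 'D_time_dir F x = - (L1 x ^+ 2 + L2 x ^+ 2) *: N x.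
  case: x => u s Ox; have [du Is nI] := OD _ Ox.
  apply: (derivative_within_time nI).
  exact: (@Hflow (par A i u) s Is).
have w0' : pinching (L1 (u0, t)) (L2 (u0, t)) != 0.
  by rewrite /L1 /L2 /= pu.
have [|dw Dw] := pinching_derivative_le0 oO Ox0 sF CD L10 L20 flow w0'.
  move=> a b; apply: (@filterE _ (nbhs (0 : R))) => s; rewrite /L1 /L2 /= pu.
  rewrite (_ : s * _ + t = t); first exact: wmax.
  by rewrite /GRing.scale /= !mulr0 addr0 mulr0 add0r.
have := derive_le0_left dw Dw e0; rewrite /L1 /L2 /= pu.
exact.
Qed.

End ConvexFlow.

Theorem theorem3p3 (R : realType) (S : topologicalType) (A : smooth_atlas R S)
    (T : \bar R) (X nu : S -> R -> 'rV[R]_3) (l1 l2 : S -> R -> R)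
    (HS : closed_surface S) (HT : (0 < T)%E)
    (HX : smooth_family A T X)
    (Hemb : forall t, time_interval T t -> embedding A (X ^~ t))
    (Hnu : forall p t, time_interval T t ->
       outer_unit_normal A (X ^~ t) p (nu p t))
    (Hl : forall p t, time_interval T t ->
       principal_curvatures A (X ^~ t) p (nu p t) (l1 p t) (l2 p t))
    (Hconv : forall p t, time_interval T t -> 0 < l1 p t /\ 0 < l2 p t)
    (Hflow : forall p t, time_interval T t ->
       derivative_within (time_interval T) (X p) t
         (- normA2 (l1 p t) (l2 p t) *: nu p t)) :
  exists m : R -> R,
    (forall t, time_interval T t ->
       is_max (range (fun p =>
           (l1 p t + l2 p t) * (l1 p t - l2 p t) ^+ 2
             / (2 * l1 p t * l2 p t))) (m t)
       /\ is_max (range (fun p =>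
           let H := mean_curvature (l1 p t) (l2 p t) in
           let A2 := normA2 (l1 p t) (l2 p t) in
           H * (2 * A2 - H ^+ 2) / (H ^+ 2 - A2))) (m t))
    /\ (forall s t, time_interval T s -> time_interval T t -> s <= t ->
          m t <= m s).
Proof.
pose wS p t := pinching (l1 p t) (l2 p t).
have [S0 _ cS _] := HS.
have near_wS := pinching_near_surface HX Hemb Hnu Hl Hconv.
have ex t : exists mt : R, time_interval T t ->
    (exists p, mt = wS p t) /\ (forall p, wS p t <= mt).
  have [It|nIt] := pselect (time_interval T t); last by exists 0.
  have cw : continuous (wS ^~ t).
    move=> p; apply/cvgrPdist_lt => e e0.
    have [[P Q] /= [P0 Q0] PQ] := near_wS p t e It e0.
    apply: filterS P0 => p' Pp'; rewrite distrC.
    by apply: (PQ (p', t)) => //; split=> //=; exact: nbhs_singleton Q0.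
  have [p _ pmax] := compact_EVT_max S0 cS (continuous_subspaceT cw).
  exists (wS p t) => _; split; first by exists p.
  by move=> p'; apply: pmax; rewrite inE.
have [m mP] := choice ex.
exists m; split.
  move=> t It; have [[p mp] mub] := mP t It.
  have M : is_max (range (wS ^~ t)) (m t).
    by split; [exists p|move=> _ [p' _ <-]].
  split=> //.
  rewrite (_ : (fun p => _) = wS ^~ t)//; apply/funext => p' /=.
  have [a0 b0] := Hconv p' t It; rewrite /mean_curvature /normA2 /wS /pinching.
  congr (_ * _ / _); ring.
move=> s t Is It st.
have sub r : s <= r -> r <= t -> time_interval T r.
  move=> sr rt; have [s0 _] := Is; have [_ tT] := It; split.
    exact: le_trans sr.
  by apply: le_lt_trans tT; rewrite lee_fin.
apply: (nonincreasing_of_left_estimate sub) => // r e sr rt e0.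
  have Ir := sub r sr rt.
  have [_ mub] := mP r Ir.
  have /compact_near_coveringP cov := cS.
  have : \forall x \near r, setT `<=` (fun p => time_interval T x -> wS p x <= m r + e).
    apply: (cov R (nbhs r) (fun x p => time_interval T x -> wS p x <= m r + e)).
    move=> p _; have [[P Q] /= [P0 Q0] PQ] := near_wS p r e Ir e0.
    exists (P, Q) => //= -[p' x] /= [Pp' Qx] Ix.
    have := PQ (p', x) (conj Pp' Qx) Ix; rewrite ltr_distl => /andP[_ H].
    by apply: le_trans (lerD (mub p) (lexx e)); rewrite ltW.
  apply: filterS => x H Ix; have [[p ->] _] := mP x Ix.
  exact: H.
have Ir := sub r (ltW sr) rt.
have [s0 _] := Is.
have r0 : 0 < r by exact: le_lt_trans sr.
have [[p mp] mub] := mP r Ir.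
have in_I : \forall x \near r^'-, time_interval T x.
  near=> x; have xr : x <= r.
    by near: x; exact: nbhs_left_le.
  apply: sub; last exact: le_trans rt.
  by near: x; exact: nbhs_left_ge.
(* if the maximum is zero, the estimate is the nonnegativity of [w] *)
have [w0|w0] := eqVneq (wS p r) 0.
  near=> x; have Ix : time_interval T x by near: x.
  have xr : x <= r by near: x; exact: nbhs_left_le.
  have [[p' mp'] _] := mP x Ix; have [a0 b0] := Hconv p' x Ix.
  rewrite mp w0 mp' sub0r; apply: le_trans (pinching_ge0 a0 b0).
  by rewrite oppr_le0 mulr_ge0 ?subr_ge0// ltW.
have := pinching_left HX Hemb Hnu Hl Hconv Hflow Ir r0 w0.
rewrite -/(wS p r) -mp => /(_ e (fun p' => _) e0).
move=> /(_ mub) F; near=> x.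
have Ix : time_interval T x by near: x.
have [_ mubx] := mP x Ix.
by apply: le_trans (mubx p); near: x.
Unshelve. all: by end_near. Qed.
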